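(* Let $\varepsilon\in(0,1)$, $d\ge 1$, and let $\{A_g\}_{g\in\mathbb{F}_q^n}$ be subsets of $\mathbb{F}_q^n$ with $\sum_g|A_g|\ge2^{-d}q^{2n}$. Let $F=\sum_g1_{A_g}\circ1_{A_g+g}$, $F'=\sum_g1_{A_g}\circ1_{A_g}$, and $D(x)=|A_x|$. Then either (1) $|\langle\mu_F,\mu_D\rangle-1|\le\varepsilon$, or (2) there is a subspace $V$ of co-dimension at most $C_\varepsilon d^8$ such that $\|\mu_{F'}*\mu_V\|_\infty\ge1+\varepsilon/32$, where $C_\varepsilon$ depends only on $\varepsilon$.
   Context: Averages are normalized over $\mathbb{F}_q^n$: $\langle f,g\rangle=\mathbb{E}_xf(x)g(x)$, $(f\circ g)(x)=\mathbb{E}_yf(y)g(x+y)$, $(f*g)(x)=\mathbb{E}_yf(y)g(x-y)$. For $f$ with $\mathbb{E}f\neq0$, $\mu_f=f/\mathbb{E}[f]$; $\mu_V=\frac{q^n}{|V|}1_V$. *)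

(* Defs.v *)
From HB Require Import structures.
From mathcomp Require Import all_boot all_order all_algebra all_field.
From mathcomp Require Import all_classical all_reals all_analysis.
Set Implicit Arguments. Unset Strict Implicit. Unset Printing Implicit Defensive.
Import Order.TTheory GRing.Theory Num.Theory.
Local Open Scope ring_scope.

Section Defs.
Variables (R : realType) (K : finFieldType) (n : nat).
Notation V := 'rV[K]_n.

Definition avg (f : V -> R) : R := (\sum_x f x) / #|{: V}|%:R.
Definition inner (f g : V -> R) : R := avg (fun x => f x * g x).
Definition corr (f g : V -> R) : V -> R := fun x => avg (fun y => f y * g (x + y)).
Definition convol (f g : V -> R) : V -> R := fun x => avg (fun y => f y * g (x - y)).
Definition ind (A : {set V}) : V -> R := fun x => (x \in A)%:R.
Definition mu_of (f : V -> R) : V -> R := fun x => f x / avg f.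
Definition mu_sub (W : {vspace V}) : V -> R :=
  fun x => (#|{: V}|%:R / #|[set y : V | y \in W]|%:R) * (x \in W)%:R.
Definition supnorm (f : V -> R) : R := \big[Num.max/0]_(x : V) `|f x|.
Definition translate (A : {set V}) (g : V) : {set V} := [set a + g | a in A].
End Defs.

(* Main.v *)
Require Import Defs.
From HB Require Import structures.
From mathcomp Require Import all_boot all_order all_algebra all_field.
From mathcomp Require Import all_classical all_reals all_analysis.
From mathcomp Require Import ring lra complex.
Import Order.TTheory GRing.Theory Num.Theory.
Local Open Scope ring_scope.
Set Implicit Arguments. Unset Strict Implicit. Unset Printing Implicit Defensive.

(* Suppose that (1) fails. Weighted power means against [D], which is bounded and
   has density at least [2 ^ -d], make an even moment of order [p = O(d)] of
   [mu_F - 1] at least about [eps ^ p]. The function [mu_F - 1] is a sum of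
   translates of autocorrelations, and [mu_F' - 1] is the same sum untranslated,
   so the moments of the latter dominate and are nonnegative. Keeping one term of
   the binomial expansion of [(1 + (mu_F' - 1)) ^ P] with [P = O(d)] then shows
   that [mu_F' ^ P] is concentrated on [S = {mu_F' >= 1 + eps / 8}]. Intersecting
   [P] random translates of random [A_g] gives a set [B] of density
   [exp (- O(d ^ 2))] with almost all differences in [S].

   The function [1_S * 1_B * 1_{-B}] is almost invariant under a subspace: random
   sampling from [B] and exponential tail bounds (Croot-Sisask) give a set [T] of
   almost periods of density [exp (- O(d ^ 8))]; smoothing repeatedly by [T - T]
   damps every frequency outside the large spectrum of [T], and by Chang's
   argument the characters in that spectrum are trivial on a subspace of
   codimension [O(d ^ 8)]. Some coset of it therefore meets [S] in proportion
   close to [1]. *)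

(** * Inequalities and finite means *)

Section OrderedFieldInequalities.
Variable R : realFieldType.
Implicit Types a b x : R.

Lemma norm_sub_itv01_le1 a b : 0 <= a <= 1 -> 0 <= b <= 1 -> `|a - b| <= 1.
Proof. by move=> /andP[a0 a1] /andP[b0 b1]; rewrite ler_norml; apply/andP; split; lra. Qed.

Lemma le_div_le1 a x : 0 <= x -> 0 < a <= 1 -> x <= x / a.
Proof. by move=> x0 /andP[a0 a1]; rewrite ler_pdivlMr // ler_piMr. Qed.

Lemma exprn_ge_tangent p a b : 0 <= a -> 0 <= b ->
  b ^+ p + p%:R * b ^+ p.-1 * (a - b) <= a ^+ p.
Proof.
move=> a0 b0; case: p => [|p] /=; first by rewrite mulr0n !mul0r addr0.
elim: p => [|p IHp]; first by rewrite !expr1 expr0; lra.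
have step := ler_wpM2l a0 IHp; rewrite [leRHS]exprS; apply: le_trans step.
have : 0 <= p.+1%:R * b ^+ p * (a - b) ^+ 2.
  by rewrite mulr_ge0 ?sqr_ge0 ?mulr_ge0 ?exprn_ge0.
rewrite -[p.+2%:R]natr1 [b ^+ p.+2]exprS [b ^+ p.+1]exprS /=.
by move: (p.+1%:R) (b ^+ p) => c y; lra.
Qed.

Lemma power_mean (I : finType) (P : pred I) (w f : I -> R) p :
  (forall i, P i -> 0 <= w i) -> \sum_(i | P i) w i = 1 ->
  `|\sum_(i | P i) w i * f i| ^+ p <= \sum_(i | P i) w i * `|f i| ^+ p.
Proof.
move=> w0 w1; set b := \sum_(i | P i) w i * `|f i|.
have b0 : 0 <= b by apply: sumr_ge0 => i Pi; rewrite mulr_ge0 ?w0.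
apply: (@le_trans _ _ (b ^+ p)).
  apply: lerXn2r; rewrite ?nnegrE //; apply: le_trans (ler_norm_sum _ _ _) _.
  by apply: ler_sum => i Pi; rewrite normrM ger0_norm ?w0.
have -> : b ^+ p = \sum_(i | P i) w i * (b ^+ p + p%:R * b ^+ p.-1 * (`|f i| - b)).
  transitivity (b ^+ p * \sum_(i | P i) w i +
      p%:R * b ^+ p.-1 * (b - b * \sum_(i | P i) w i)).
    by rewrite w1 !mulr1 subrr mulr0 addr0.
  rewrite {3}/b !mulr_sumr -sumrB mulr_sumr -big_split /=.
  by apply: eq_bigr => i _; ring.
by apply: ler_sum => i Pi; rewrite ler_wpM2l ?w0 ?exprn_ge_tangent.
Qed.

End OrderedFieldInequalities.

Section ExponentialInequalities.
Variable R : realType.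
Implicit Types x : R.

Lemma expR_mul_1B_le1 x : (1 - x) * expR x <= 1.
Proof.
by rewrite -ler_pdivlMr ?expR_gt0 // div1r -expRN; exact: expR_ge1Dx.
Qed.

Lemma expR_le_quadratic x : x <= 1 / 2 -> expR x <= 1 + x + 2 * x ^+ 2.
Proof.
move=> x_le; have x1 : 0 < 1 - x by lra.
rewrite -(ler_pM2l x1); apply: le_trans (expR_mul_1B_le1 x) _.
have : 0 <= x ^+ 2 * (1 - 2 * x) by rewrite mulr_ge0 ?sqr_ge0 //; lra.
lra.
Qed.

Lemma exprn_1D_le_expR x p : 0 <= x -> (1 + x) ^+ p <= expR (p%:R * x).
Proof.
move=> x0; rewrite expRM_natl; apply: lerXn2r; last exact: expR_ge1Dx.
  by rewrite nnegrE addr_ge0.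
by rewrite nnegrE expR_ge0.
Qed.

Lemma exists_natr_between_add1 x : 0 <= x -> exists2 k, (0 < k)%N & x <= k%:R <= x + 1.
Proof.
move=> x0; exists (Num.truncn x).+1 => //.
by rewrite -natr1 lerD2r truncn_le x0 natr1 ltW // truncnS_gt.
Qed.

End ExponentialInequalities.

Lemma card_setT_finZmod_gt0 (G : finZmodType) : (0 < #|[set: G]|)%N.
Proof. by rewrite cardsT; apply/card_gt0P; exists 0. Qed.

Lemma natr_card_finZmod_gt0 (R : numDomainType) (G : finZmodType) : 0 < #|G|%:R :> R.
Proof. by rewrite ltr0n -cardsT card_setT_finZmod_gt0. Qed.

Section Mean.
Variables (R : numFieldType) (T : finType).
Implicit Types (A : {set T}) (f g : T -> R) (k : R).

(* The mean over the empty set is 0, since [x / 0 = 0]. *)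
Definition mean A f : R := (\sum_(a in A) f a) / #|A|%:R.

Lemma mean_setT f : mean [set: T] f = (\sum_x f x) / #|T|%:R.
Proof. by rewrite /mean cardsT; congr (_ / _); apply: eq_bigl => x; rewrite inE. Qed.

Lemma eq_mean A f g : (forall x, x \in A -> f x = g x) -> mean A f = mean A g.
Proof. by move=> fg; congr (_ / _); exact: eq_bigr. Qed.

Lemma mean_mem A (S : {set T}) :
  mean A (fun x => (x \in S)%:R) = #|A :&: S|%:R / #|A|%:R.
Proof.
congr (_ / _); rewrite -sum1_card natr_sum big_mkcond [RHS]big_mkcond /=.
by apply: eq_bigr => x _; rewrite inE; case: (x \in A); case: (x \in S).
Qed.

Lemma mean_mem_setT (S : {set T}) :
  mean [set: T] (fun x => (x \in S)%:R) = #|S|%:R / #|T|%:R.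
Proof. by rewrite mean_mem finset.setTI cardsT. Qed.

Lemma meanD A f g : mean A (fun x => f x + g x) = mean A f + mean A g.
Proof. by rewrite /mean big_split mulrDl. Qed.

Lemma meanB A f g : mean A (fun x => f x - g x) = mean A f - mean A g.
Proof. by rewrite /mean sumrB mulrBl. Qed.

Lemma meanN A f : mean A (fun x => - f x) = - mean A f.
Proof. by rewrite /mean sumrN mulNr. Qed.

Lemma meanZl A k f : mean A (fun x => k * f x) = k * mean A f.
Proof. by rewrite /mean -mulr_sumr mulrA. Qed.

Lemma meanZr A k f : mean A (fun x => f x * k) = mean A f * k.
Proof. by rewrite /mean -mulr_suml mulrAC. Qed.

Lemma ler_mean A f g : (forall x, x \in A -> f x <= g x) -> mean A f <= mean A g.
Proof. by move=> fg; rewrite ler_wpM2r ?invr_ge0 //; apply: ler_sum. Qed.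

Lemma mean_ge0 A f : (forall x, x \in A -> 0 <= f x) -> 0 <= mean A f.
Proof. by move=> f0; rewrite divr_ge0 //; apply: sumr_ge0. Qed.

Lemma mean_le_sum A f : (forall x, 0 <= f x) -> mean A f <= (\sum_x f x) / #|A|%:R.
Proof.
move=> f0; rewrite ler_wpM2r ?invr_ge0 // [leRHS](bigID (mem A)) /= lerDl.
by apply: sumr_ge0.
Qed.

Lemma ler_norm_mean A f : `|mean A f| <= mean A (fun x => `|f x|).
Proof. by rewrite normrM normfV normr_nat ler_wpM2r ?invr_ge0 // ler_norm_sum. Qed.

Section Nonempty.
Variable A : {set T}.
Hypothesis A_gt0 : (0 < #|A|)%N.

Lemma mean_cst k : mean A (fun=> k) = k.
Proof. by rewrite /mean sumr_const -[k *+ _]mulr_natr mulfK // pnatr_eq0 -lt0n. Qed.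

Lemma mean_le f k : (forall x, x \in A -> f x <= k) -> mean A f <= k.
Proof. by move=> fk; rewrite -[leRHS]mean_cst ler_mean. Qed.

Lemma norm_mean_le f k : (forall x, x \in A -> `|f x| <= k) -> `|mean A f| <= k.
Proof. by move=> fk; apply: le_trans (ler_norm_mean _ _) _; exact: mean_le. Qed.

Lemma mean_itv01 f : (forall x, x \in A -> 0 <= f x <= 1) -> 0 <= mean A f <= 1.
Proof. by move=> f01; rewrite mean_ge0 ?mean_le // => x /f01/andP[]. Qed.

End Nonempty.
End Mean.

Lemma mean_exchange (R : numFieldType) (T U : finType) (A : {set T}) (B : {set U})
    (F : T -> U -> R) :
  mean A (fun a => mean B (F a)) = mean B (fun b => mean A (F^~ b)).
Proof. by rewrite /mean -!mulr_suml exchange_big mulrAC. Qed.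

Lemma rmorph_mean (R S : numFieldType) (h : {rmorphism R -> S}) (T : finType) (A : {set T})
    (f : T -> R) :
  h (mean A f) = mean A (fun x => h (f x)).
Proof. by rewrite /mean rmorphM rmorph_sum fmorphV rmorph_nat. Qed.

Lemma mean_setX (R : numFieldType) (T U : finType) (A : {set T}) (B : {set U})
    (F : T -> U -> R) :
  mean (finset.setX A B) (fun q => F q.1 q.2) = mean A (fun a => mean B (F a)).
Proof.
rewrite /mean -mulr_suml -mulrA -invfM -natrM cardsX mulnC pair_big /=.
by congr (_ / _); apply: eq_bigl => -[a b]; rewrite !inE.
Qed.

Lemma mean_reindex_inj (R : numFieldType) (T : finType) (h : T -> T) (f : T -> R) :
  injective h -> mean [set: T] (fun x => f (h x)) = mean [set: T] f.
Proof. by move=> h_inj; rewrite !mean_setT [in RHS](reindex_inj h_inj). Qed.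

Section MeanRealField.
Variables (R : realFieldType) (T : finType) (A : {set T}).
Implicit Types (f : T -> R) (k : R).

Lemma mean_markov f k : (forall x, x \in A -> 0 <= f x) ->
  mean A (fun x => (k < f x)%R%:R) * k <= mean A f.
Proof.
move=> f0; rewrite -meanZr; apply: ler_mean => x xA.
by case: ltP => kf; rewrite ?mul1r ?mul0r ?f0 // ltW.
Qed.

Hypothesis A_gt0 : (0 < #|A|)%N.

Lemma exists_ge_mean f k : k <= mean A f -> exists2 x, x \in A & k <= f x.
Proof.
move=> k_le; apply: contrapT => none_ge.
have f_lt x : x \in A -> f x < k.
  by move=> xA; rewrite ltNge; apply/negP => kf; apply: none_ge; exists x.
have [x xA] := card_gt0P A_gt0.
suff : mean A f < mean A (fun=> k) by rewrite mean_cst // ltNge k_le.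
rewrite ltr_pM2r ?invr_gt0 ?ltr0n //; apply: ltr_sum => //; apply/hasP.
by exists x; rewrite ?mem_index_enum.
Qed.

Lemma norm_mean_exprn_le f p : `|mean A f| ^+ p <= mean A (fun x => `|f x| ^+ p).
Proof.
have := @power_mean R T (mem A) (fun=> #|A|%:R^-1) f p.
rewrite -!mulr_sumr sumr_const -[_^-1 *+ _]mulr_natr mulVf ?pnatr_eq0 -?lt0n //.
by rewrite ![_^-1 * _]mulrC; apply=> // x _; rewrite invr_ge0.
Qed.

End MeanRealField.

Section MeanExponential.
Variables (R : realType) (T : finType) (A : {set T}).
Implicit Types (f : T -> R) (k : R).

Lemma mean_chernoff f k c : 0 < c ->
  mean A (fun x => (k < f x)%R%:R) <= expR (- (c * k)) * mean A (fun x => expR (c * f x)).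
Proof.
move=> c0; rewrite expRN [leRHS]mulrC ler_pdivlMr ?expR_gt0 //.
apply: le_trans (mean_markov (expR (c * k)) (fun x _ => expR_ge0 _)).
rewrite ler_wpM2r ?expR_ge0 //.
by apply: ler_mean => x _; rewrite ltr_expR ltr_pM2l.
Qed.

Hypothesis A_gt0 : (0 < #|A|)%N.

Lemma expR_mean_le f : expR (mean A f) <= mean A (fun x => expR (f x)).
Proof.
set m := mean A f.
rewrite -[leLHS]mulr1 -[X in _ * X <= _](_ : mean A (fun x => 1 + (f x - m)) = 1).
  rewrite -meanZl; apply: ler_mean => x _.
  by rewrite -[f x in leRHS](subrKC m) expRD ler_pM2l ?expR_gt0 ?expR_ge1Dx.
by rewrite meanD meanB !mean_cst // subrr addr0.
Qed.

Lemma mean_expR_centered_le f k : `|k| <= 1 / 2 ->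
  (forall x, x \in A -> `|f x| <= 1) -> mean A f = 0 ->
  mean A (fun x => expR (k * f x)) <= expR (2 * k ^+ 2).
Proof.
move=> k_le f_le f_mean.
apply: (@le_trans _ _ (mean A (fun x => expR (2 * k ^+ 2) + k * f x))); last first.
  by rewrite meanD meanZl f_mean mulr0 addr0 mean_cst.
apply: ler_mean => x /f_le fx1.
have kfx : `|k * f x| <= `|k| by rewrite normrM ler_piMr.
apply: le_trans (expR_le_quadratic _) _.
  by apply: le_trans (ler_norm _) _; exact: le_trans kfx k_le.
have : (k * f x) ^+ 2 <= k ^+ 2.
  by rewrite -(real_normK (num_real (k * f x))) -(real_normK (num_real k)) lerXn2r ?nnegrE.
by have := expR_ge1Dx (2 * k ^+ 2); lra.
Qed.

End MeanExponential.

(** * Moments of sums of autocorrelations *)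

Section AutocorrelationMoments.
Variables (R : realFieldType) (G : finZmodType).

Definition autocorr (b : G -> R) (x : G) : R := \sum_y b y * b (x + y).

Lemma sum_autocorr (b : G -> R) (z : G) : \sum_x autocorr b (x - z) = (\sum_y b y) ^+ 2.
Proof.
rewrite exchange_big /= expr2 mulr_suml; apply: eq_bigr => y _.
rewrite -mulr_sumr (reindex_inj (addIr (z - y))) /=; congr (_ * _).
by apply: eq_bigr => x _; rewrite addrAC -[x + _ + y]addrA subrK addrK.
Qed.

Lemma autocorr_sub_mean (b : G -> R) (x : G) :
  autocorr (fun y => b y - mean [set: G] b) x = autocorr b x - (\sum_y b y) ^+ 2 / #|G|%:R.
Proof.
rewrite mean_setT; set m := _ / _.
have shifted_sum : \sum_y b (x + y) = \sum_y b y by rewrite [RHS](reindex_inj (addrI x)).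
have -> : autocorr (fun y => b y - m) x =
    autocorr b x - (m * \sum_y b y + m * \sum_y b (x + y) - \sum_(y : G) m ^+ 2).
  by rewrite !mulr_sumr -big_split -!sumrB; apply: eq_bigr => y _ /=; ring.
rewrite shifted_sum sumr_const -[m ^+ 2 *+ _]mulr_natr /m; field.
by rewrite gt_eqF ?natr_card_finZmod_gt0.
Qed.

Lemma norm_sum_mul_shift_le (f : G -> R) (z : G) :
  `|\sum_x f x * f (x - z)| <= \sum_x f x ^+ 2.
Proof.
have -> : \sum_x f x ^+ 2 = \sum_x (f x ^+ 2 + f (x - z) ^+ 2) / 2.
  rewrite -mulr_suml big_split /= [X in _ + X](_ : _ = \sum_x f x ^+ 2); last first.
    by rewrite [RHS](reindex_inj (addIr (- z))).
  by lra.
apply: le_trans (ler_norm_sum _ _ _) _; apply: ler_sum => x _.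
have := sqr_ge0 (f x - f (x - z)); have := sqr_ge0 (f x + f (x - z)).
by rewrite ler_norml => ? ?; apply/andP; split; lra.
Qed.

End AutocorrelationMoments.

Section CorrelationAlongSubgroup.
Variables (R : realFieldType) (G X : finZmodType) (phi : G -> X) (h : X -> R).
Hypothesis phiD : {morph phi : x y / x + y}.

Let orbit_sum (y : X) : R := \sum_x h (y + phi x).

Lemma sum_mul_orbit_sum (s : X) :
  \sum_y orbit_sum y * orbit_sum (y - s) =
  #|G|%:R * \sum_x \sum_y h y * h (y + phi x - s).
Proof.
transitivity (\sum_y \sum_z \sum_x h (y + phi z) * h (y + phi z + phi x - s)).
  apply: eq_bigr => y _; rewrite mulr_suml; apply: eq_bigr => z _.
  rewrite mulr_sumr (reindex_inj (addIr z)); apply: eq_bigr => x _.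
  by rewrite phiD [phi x + _]addrC addrAC !addrA.
rewrite mulr_natl -sumr_const exchange_big; apply: eq_bigr => z _.
rewrite exchange_big; apply: eq_bigr => x _.
by rewrite [RHS](reindex_inj (addIr (phi z))).
Qed.

Lemma norm_correlation_shift_le (s : X) :
  `|\sum_x \sum_y h y * h (y + phi x - s)| <= \sum_x \sum_y h y * h (y + phi x).
Proof.
have diagonal : \sum_y orbit_sum y ^+ 2 = #|G|%:R * \sum_x \sum_y h y * h (y + phi x).
  transitivity (\sum_y orbit_sum y * orbit_sum (y - 0)).
    by apply: eq_bigr => y _; rewrite subr0.
  rewrite sum_mul_orbit_sum; congr (_ * _).
  by do 2![apply: eq_bigr => ? _]; rewrite subr0.
have G_gt0 := natr_card_finZmod_gt0 R G.
rewrite -(ler_pM2l G_gt0) -diagonal -{1}(gtr0_norm G_gt0) -normrM -sum_mul_orbit_sum.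
exact: norm_sum_mul_shift_le.
Qed.

End CorrelationAlongSubgroup.

HB.instance Definition _ (aT : finType) (G : finZmodType) := GRing.Zmodule.on {ffun aT -> G}.

Section Moments.
Variables (R : realFieldType) (G : finZmodType) (I : finType) (b : I -> G -> R) (p : nat).

(* Expanding the [p]-th power turns each moment into a sum of correlations on
   [G ^ p] along the diagonal, to which Cauchy-Schwarz applies. *)
Lemma norm_moment_shift_le (z : I -> G) :
  `|\sum_x (\sum_i autocorr (b i) (x - z i)) ^+ p| <=
  \sum_x (\sum_i autocorr (b i) x) ^+ p.
Proof.
pose h (u : {ffun 'I_p -> I}) (y : {ffun 'I_p -> G}) := \prod_j b (u j) (y j).
pose diag (x : G) : {ffun 'I_p -> G} := [ffun=> x].
have diagD : {morph diag : x y / x + y} by move=> x y; apply/ffunP => i; rewrite !ffunE.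
have expand (s : I -> G) x : (\sum_i autocorr (b i) (x - s i)) ^+ p =
    \sum_u \sum_y h u y * h u (y + diag x - [ffun j => s (u j)]).
  rewrite -[in LHS](card_ord p) -prodr_const bigA_distr_bigA /=.
  apply: eq_bigr => u _; rewrite bigA_distr_bigA /=; apply: eq_bigr => y _.
  rewrite /h -big_split /=; apply: eq_bigr => j _; rewrite !ffunE.
  by congr (_ * b _ _); rewrite [LHS]addrC addrA.
have expand0 x : (\sum_i autocorr (b i) x) ^+ p = \sum_u \sum_y h u y * h u (y + diag x).
  have := expand (fun=> 0) x; under eq_bigr => i _ do rewrite subr0.
  move=> ->; apply: eq_bigr => u _; apply: eq_bigr => y _.
  by congr (_ * h u _); apply/ffunP => j; rewrite !ffunE subr0.
under eq_bigr => x _ do rewrite expand.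
under [leRHS]eq_bigr => x _ do rewrite expand0.
rewrite exchange_big /= [leRHS]exchange_big /=.
apply: le_trans (ler_norm_sum _ _ _) _; apply: ler_sum => u _.
exact: (norm_correlation_shift_le (h u) diagD).
Qed.

Lemma moment_autocorr_ge0 : 0 <= \sum_x (\sum_i autocorr (b i) x) ^+ p.
Proof. exact: le_trans (norm_moment_shift_le (fun=> 0)). Qed.

End Moments.

Lemma ffact_mul_ge m k n p : (0 < m)%N -> (m * k <= n)%N -> (m ^ p * k ^_ p <= n ^_ p)%N.
Proof.
move=> m_gt0; elim: p k n => [|p IHp] k n mk_le; first by rewrite !ffactn0.
case: k mk_le => [|k] mk_le; first by rewrite ffact0n /= muln0.
case: n mk_le => [|n] mk_le; first by rewrite leqn0 muln_eq0 eqn0Ngt m_gt0 in mk_le.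
rewrite !ffactSS expnS mulnACA leq_mul //; apply: IHp.
by rewrite -ltnS; apply: leq_trans mk_le; rewrite mulnS -add1n leq_add2r.
Qed.

Lemma expn_le_bin m p : (0 < m)%N -> (m ^ p <= 'C(m * p, p))%N.
Proof.
move=> m_gt0; rewrite -(leq_pmul2r (fact_gt0 p)) bin_ffact -ffactnn.
exact: ffact_mul_ge.
Qed.

(** * Functions with nonnegative central moments *)

Section CentralMoments.
Variables (R : realFieldType) (T : finType) (f : T -> R).
Hypothesis moments_ge0 : forall j, 0 <= \sum_x (f x - 1) ^+ j.

Lemma bin_mul_central_moment_le n p : (p <= n)%N ->
  'C(n, p)%:R * \sum_x (f x - 1) ^+ p <= \sum_x f x ^+ n.
Proof.
rewrite -ltnS => p_lt.
have -> : \sum_x f x ^+ n = \sum_(i < n.+1) 'C(n, i)%:R * \sum_x (f x - 1) ^+ i.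
  under [RHS]eq_bigr => i _ do rewrite mulr_sumr.
  rewrite exchange_big /=; apply: eq_bigr => x _.
  rewrite -[f x in LHS](subrKC 1) exprDn; apply: eq_bigr => i _.
  by rewrite expr1n mul1r mulr_natl.
rewrite (bigD1 (Ordinal p_lt)) //= lerDl.
by apply: sumr_ge0 => i _; rewrite mulr_ge0.
Qed.

Lemma card_le_moment n : #|T|%:R <= \sum_x f x ^+ n.
Proof.
apply: le_trans (bin_mul_central_moment_le (leq0n n)).
by under eq_bigr => x _ do rewrite expr0; rewrite bin0 mul1r sumr_const.
Qed.

Lemma expn_mul_central_moment_le m p : (0 < m)%N ->
  m%:R ^+ p * \sum_x (f x - 1) ^+ p <= \sum_x f x ^+ (m * p).
Proof.
move=> m_gt0; apply: le_trans (bin_mul_central_moment_le (leq_pmull p m_gt0)).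
by rewrite ler_wpM2r // -natrX ler_nat expn_le_bin.
Qed.

Lemma lower_level_moment_le (k : R) n : (forall x, 0 <= f x) -> 0 <= k ->
  \sum_(x | f x < k) f x ^+ n <= k ^+ n * #|T|%:R.
Proof.
move=> f0 k0; rewrite mulr_natr -sumr_const [leRHS](bigID (fun x => f x < k)) /=.
rewrite -[leLHS]addr0 lerD ?sumr_ge0 // => [|x _]; last exact: exprn_ge0.
by apply: ler_sum => x /ltW; apply: lerXn2r; rewrite nnegrE.
Qed.

End CentralMoments.

(* With [M ~ 4 / eps] the moment of order [2 * m * M] is at least [16 ^ m * t * #|T|],
   whereas below the level [1 + eps / 8] it is at most [(64 / 9) ^ m * #|T|]. *)
Lemma lower_level_moment_negligible (R : realType) (T : finType) (f : T -> R)
    (eps t theta : R) M m :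
  (forall x, 0 <= f x) -> (forall j, 0 <= \sum_x (f x - 1) ^+ j) ->
  0 < eps -> 0 < t -> 0 < theta -> 4 <= M%:R * eps <= 5 ->
  1 <= t * 2 ^+ m -> 1 <= theta * (9 / 8) ^+ m ->
  t * eps ^+ (2 * m) * #|T|%:R <= \sum_x (f x - 1) ^+ (2 * m) ->
  \sum_(x | f x < 1 + eps / 8) f x ^+ (M * (2 * m)) <= theta * \sum_x f x ^+ (M * (2 * m)).
Proof.
move=> f0 moments_ge0 eps0 t0 theta0 /andP[Meps4 Meps5] t_m theta_m moment_ge.
have M_gt0 : (0 < M)%N by rewrite -(ltr0n R) -(pmulr_lgt0 _ eps0); lra.
have level_le : (1 + eps / 8) ^+ (M * (2 * m)) <= (64 / 9) ^+ m.
  have power_le : (1 + eps / 8) ^+ M <= 8 / 3.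
    apply: le_trans (exprn_1D_le_expR _ _) _; first by rewrite divr_ge0 ?ltW.
    set y := _ * _; have y_le : y <= 5 / 8 by rewrite /y; lra.
    have := expR_mul_1B_le1 y; have : 0 <= (5 / 8 - y) * expR y; last lra.
    by rewrite mulr_ge0 ?expR_ge0 // subr_ge0.
  have -> : 64 / 9 = (8 / 3) ^+ 2 :> R by lra.
  have level_ge0 : 0 <= 1 + eps / 8 by rewrite addr_ge0 ?divr_ge0 ?ltW.
  by rewrite exprM -[leRHS]exprM; apply: lerXn2r; rewrite // nnegrE ?exprn_ge0 ?divr_ge0.
have moment_lower : 16 ^+ m * t * #|T|%:R <= \sum_x f x ^+ (M * (2 * m)).
  apply: le_trans (expn_mul_central_moment_le moments_ge0 (2 * m) M_gt0).
  apply: le_trans (ler_wpM2l _ moment_ge); last by rewrite exprn_ge0.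
  have -> : M%:R ^+ (2 * m) * (t * eps ^+ (2 * m) * #|T|%:R) =
      (M%:R * eps) ^+ (2 * m) * t * #|T|%:R by rewrite exprMn; ring.
  rewrite !ler_wpM2r ?(ltW t0) // exprM; apply: lerXn2r; rewrite ?nnegrE ?sqr_ge0 //.
  by nra.
apply: le_trans (lower_level_moment_le _ f0 _) _; first by rewrite addr_ge0 ?divr_ge0 ?ltW.
apply: le_trans (ler_wpM2l (ltW theta0) moment_lower).
rewrite !mulrA ler_wpM2r //; apply: le_trans level_le _.
have -> : theta * 16 ^+ m * t = (64 / 9) ^+ m * ((theta * (9 / 8) ^+ m) * (t * 2 ^+ m)).
  have -> : 16 = 64 / 9 * (9 / 8) * 2 :> R by lra.
  by rewrite !exprMn; ring.
by rewrite ler_peMr ?exprn_ge0 ?divr_ge0 // -[leLHS]mulr1; apply: ler_pM.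
Qed.

(** * Dependent random choice *)

Lemma natr_forall (R : comPzSemiRingType) (I : finType) (P : pred I) :
  [forall i, P i]%:R = \prod_i (P i)%:R :> R.
Proof.
have [/forallP P_all | ] := boolP [forall i, P i].
  by rewrite big1 // => i _; rewrite P_all.
by rewrite negb_forall => /existsP[i /negbTE nPi]; rewrite (bigD1 i) //= nPi mul0r.
Qed.

Section DependentRandomChoice.
Variables (R : realFieldType) (T I : finType) (E : I -> {set T}) (p : nat).

Definition common (u : {ffun 'I_p -> I}) : {set T} := [set x | [forall j, x \in E (u j)]].

Definition codegree (x y : T) : R := \sum_i (x \in E i)%:R * (y \in E i)%:R.

Lemma sum_common_pairs (w : T -> T -> R) :
  \sum_u \sum_(x in common u) \sum_(y in common u) w x y =
  \sum_x \sum_y w x y * codegree x y ^+ p.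
Proof.
transitivity (\sum_u \sum_x \sum_y w x y * ((x \in common u)%:R * (y \in common u)%:R)).
  apply: eq_bigr => u _; rewrite big_mkcond /=; apply: eq_bigr => x _.
  case: (x \in common u); last by rewrite big1 // => y _; rewrite mul0r mulr0.
  rewrite big_mkcond /=; apply: eq_bigr => y _.
  by case: (y \in common u); rewrite mul1r ?mulr1 ?mulr0.
rewrite exchange_big; apply: eq_bigr => x _; rewrite exchange_big; apply: eq_bigr => y _.
rewrite -mulr_sumr; congr (_ * _); rewrite -[in RHS](card_ord p) -prodr_const bigA_distr_bigA.
by apply: eq_bigr => u _; rewrite !inE !natr_forall big_split.
Qed.

Lemma exists_sum_common_pairs_ge (w : T -> T -> R) (k : R) :
  0 < k -> k <= \sum_x \sum_y w x y * codegree x y ^+ p ->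
  exists u, k <= #|I|%:R ^+ p * \sum_(x in common u) \sum_(y in common u) w x y.
Proof.
move=> k0; rewrite -sum_common_pairs => k_le.
have U_gt0 : (0 < #|[set: {ffun 'I_p -> I}]|)%N.
  rewrite lt0n cardsT; apply: contraTneq k_le => /card0_eq no_u.
  by rewrite big_pred0 // -ltNge.
have Ip_gt0 : 0 < #|I|%:R ^+ p :> R.
  by rewrite -natrX ltr0n -[p in (_ ^ p)%N]card_ord -card_ffun -cardsT.
pose W u := \sum_(x in common u) \sum_(y in common u) w x y.
have [|u _ W_ge] := exists_ge_mean (f := W) (k := k / #|I|%:R ^+ p) U_gt0; last first.
  by exists u; rewrite mulrC -ler_pdivrMr.
by rewrite mean_setT card_ffun card_ord natrX ler_wpM2r // invr_ge0 ltW.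
Qed.

(* The weight of a pair is at most [1] and very negative on bad pairs, so that one
   average controls both the size of [common u] and its proportion of bad pairs. *)
Definition discount (P : rel T) (k : R) (x y : T) : R := 1 - (1 - (P x y)%:R) / k.

Lemma sum_discount (P : rel T) (k : R) (B : {set T}) : (0 < #|B|)%N ->
  \sum_(x in B) \sum_(y in B) discount P k x y =
  #|B|%:R ^+ 2 * (1 - (1 - mean B (fun x => mean B (fun y => (P x y)%:R))) / k).
Proof.
move=> B_gt0; have b_neq0 : #|B|%:R ^+ 2 != 0 :> R by rewrite expf_neq0 // pnatr_eq0 -lt0n.
have mean_affine f : mean B (fun x => 1 - (1 - f x) / k) = 1 - (1 - mean B f) / k.
  by rewrite meanB meanZr meanB !mean_cst.
transitivity (#|B|%:R ^+ 2 * mean B (fun x => mean B (discount P k x))).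
  by rewrite /mean -mulr_suml -mulrA -invfM -expr2 mulrC mulfVK.
by rewrite -mean_affine; congr (_ * _); apply: eq_mean => x _; rewrite -mean_affine.
Qed.

Lemma sum_discount_codegree (P : rel T) (k : R) :
  \sum_x \sum_y discount P k x y * codegree x y ^+ p =
  \sum_x \sum_y codegree x y ^+ p - (\sum_x \sum_(y | ~~ P x y) codegree x y ^+ p) / k.
Proof.
rewrite mulr_suml -sumrB; apply: eq_bigr => x _.
rewrite [X in _ - X / _]big_mkcond mulr_suml -sumrB; apply: eq_bigr => y _ /=.
by rewrite /discount; case: (P x y) => /=; ring.
Qed.

Lemma dependent_random_choice (P : rel T) (theta : R) : 0 < theta ->
  0 < \sum_x \sum_y codegree x y ^+ p ->
  \sum_x \sum_(y | ~~ P x y) codegree x y ^+ p <= theta * \sum_x \sum_y codegree x y ^+ p ->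
  exists B : {set T}, [/\ (0 < #|B|)%N,
    \sum_x \sum_y codegree x y ^+ p <= 2 * #|I|%:R ^+ p * #|B|%:R ^+ 2 &
    1 - 2 * theta <= mean B (fun x => mean B (fun y => (P x y)%:R))].
Proof.
set total := \sum_x \sum_y _ => theta0 total_gt0 bad_le.
have theta2_gt0 : 0 < 2 * theta by lra.
have [||u] := @exists_sum_common_pairs_ge (discount P (2 * theta)) (total / 2).
- by lra.
- rewrite sum_discount_codegree -/total.
  suff : (\sum_x \sum_(y | ~~ P x y) codegree x y ^+ p) / (2 * theta) <= total / 2 by lra.
  by rewrite ler_pdivrMr //; apply: le_trans bad_le _; lra.
set B := common u => W_ge.
have W_gt0 : 0 < #|I|%:R ^+ p * \sum_(x in B) \sum_(y in B) discount P (2 * theta) x y.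
  by apply: lt_le_trans W_ge; lra.
have B_gt0 : (0 < #|B|)%N.
  rewrite lt0n cards_eq0; apply: contraTneq W_gt0 => ->.
  by rewrite big_set0 mulr0 ltxx.
rewrite (sum_discount P (2 * theta) B_gt0) mulrA in W_ge W_gt0; exists B.
set good := mean B _ in W_ge W_gt0 *.
have b_ge0 : 0 <= #|I|%:R ^+ p * #|B|%:R ^+ 2 :> R by rewrite mulr_ge0 ?exprn_ge0.
have good_gt : (1 - good) / (2 * theta) < 1.
  rewrite ltNge; apply: contraTN W_gt0 => loss_ge1.
  by rewrite -leNgt mulr_ge0_le0 // subr_le0.
have good_le1 : good <= 1 by do 2![apply: mean_le => // ? _]; case: (P _ _).
split=> //; last by move: good_gt; rewrite ltr_pdivrMr // mul1r; lra.
have : 0 <= (1 - good) / (2 * theta) by rewrite divr_ge0 ?(ltW theta2_gt0) // subr_ge0.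
by move=> loss_ge0; have := mulr_ge0 b_ge0 loss_ge0; lra.
Qed.

End DependentRandomChoice.

(** * Almost periods by random sampling *)

Section Sampling.
Variables (R : realType) (T : finType) (A : {set T}) (l : nat).

Definition samples : {set {ffun 'I_l -> T}} := [set u in ffun_on (mem A)].

Lemma card_samples : #|samples| = (#|A| ^ l)%N.
Proof. by rewrite cardsE card_ffun_on card_ord. Qed.

Lemma mean_samples_prod (F : T -> R) :
  mean samples (fun u => \prod_i F (u i)) = mean A F ^+ l.
Proof.
rewrite /mean card_samples natrX expr_div_n; congr (_ / _).
rewrite -[in RHS](card_ord l) -prodr_const (bigA_distr_big (mem A)) /=.
by apply: eq_bigl => u; rewrite inE.
Qed.

Hypothesis A_gt0 : (0 < #|A|)%N.

Lemma card_samples_gt0 : (0 < #|samples|)%N.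
Proof. by rewrite card_samples expn_gt0 A_gt0. Qed.

Lemma sampling_tail (X : T -> R) (delta : R) : 0 < delta <= 1 ->
  (forall a, a \in A -> `|X a| <= 1) -> mean A X = 0 ->
  mean samples (fun u => (delta * l%:R < \sum_i X (u i))%R%:R) <=
  expR (- (delta ^+ 2 * l%:R / 8)).
Proof.
move=> /andP[delta0 delta1] X_le X_mean; have delta4_gt0 : 0 < delta / 4 by lra.
apply: le_trans (mean_chernoff _ (fun u : {ffun 'I_l -> T} => \sum_i X (u i)) _ delta4_gt0) _.
have mgf_le : mean samples (fun u => expR (delta / 4 * \sum_i X (u i))) <=
    expR (2 * (delta / 4) ^+ 2 * l%:R).
  under eq_mean => u _ do rewrite mulr_sumr expR_sum.
  rewrite (mean_samples_prod (fun a => expR (delta / 4 * X a))) [_ * l%:R]mulrC expRM_natl.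
  apply: lerXn2r; rewrite ?nnegrE ?expR_ge0 //.
    by apply: mean_ge0 => a _; exact: expR_ge0.
  by apply: mean_expR_centered_le => //; rewrite ger0_norm; lra.
apply: le_trans (ler_wpM2l (expR_ge0 _) mgf_le) _.
by rewrite -expRD ler_expR; lra.
Qed.

Lemma sampling_deviation (f : T -> R) (delta : R) : (0 < l)%N -> 0 < delta <= 1 ->
  (forall a, a \in A -> 0 <= f a <= 1) ->
  mean samples (fun u => (delta < `|mean A f - mean [set: 'I_l] (fun i => f (u i))|)%R%:R) <=
  2 * expR (- (delta ^+ 2 * l%:R / 8)).
Proof.
move=> l_gt0 delta01 f01; pose X a := f a - mean A f.
have natr_l_gt0 : 0 < l%:R :> R by rewrite ltr0n.
have X_mean : mean A X = 0 by rewrite meanB mean_cst // subrr.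
have X_le a : a \in A -> `|X a| <= 1.
  by move=> /f01 fa01; apply: norm_sub_itv01_le1 => //; exact: mean_itv01.
have upper := sampling_tail delta01 X_le X_mean.
have lower : mean samples (fun u => (delta * l%:R < \sum_i - X (u i))%R%:R) <=
    expR (- (delta ^+ 2 * l%:R / 8)).
  apply: (@sampling_tail (fun a => - X a)) => // [a /X_le|]; first by rewrite normrN.
  by rewrite meanN X_mean oppr0.
rewrite mulr_natl; apply: le_trans (lerD upper lower); rewrite -meanD.
apply: ler_mean => u _; rewrite sumrN.
have -> : \sum_i X (u i) = (mean [set: 'I_l] (fun i => f (u i)) - mean A f) * l%:R.
  rewrite sumrB sumr_const card_ord -[mean A f *+ l]mulr_natr.
  by rewrite mulrBl mean_setT card_ord mulfVK ?gt_eqF.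
rewrite -[- (_ * l%:R)]mulNr !ltr_pM2r // opprB distrC -natrD ler_nat ltr_normr opprB.
by do 2!case: (_ < _).
Qed.

End Sampling.

Lemma exists_dense_fiber (R : realFieldType) (G X : finZmodType) (phi : G -> X) (L : {set X}) :
  exists u, #|L|%:R / #|X|%:R <= #|[set t | u - phi t \in L]|%:R / #|G|%:R :> R.
Proof.
have X_gt0 := card_setT_finZmod_gt0 X; have G_gt0 := card_setT_finZmod_gt0 G.
pose fiber (u : X) := mean [set: G] (fun t => (u - phi t \in L)%:R : R).
have [|u _ u_ge] := exists_ge_mean (f := fiber) (k := #|L|%:R / #|X|%:R) X_gt0; last first.
  exists u; apply: le_trans u_ge _; rewrite -mean_mem_setT; apply: ler_mean => t _.
  by rewrite inE.
rewrite mean_exchange -[leLHS](mean_cst G_gt0); apply: ler_mean => t _.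
by rewrite (mean_reindex_inj (fun u => (u \in L)%:R : R) (addIr (- phi t))) mean_mem_setT.
Qed.

Section TranslateMean.
Variables (R : numFieldType) (G : zmodType).

Definition translate_mean (I : finType) (A : {set I}) (phi : I -> G) (f : G -> R) : G -> R :=
  fun x => mean A (fun i => f (x + phi i)).

Lemma translate_mean_comm (I J : finType) (A : {set I}) (B : {set J})
    (phi : I -> G) (psi : J -> G) (f : G -> R) :
  translate_mean A phi (translate_mean B psi f) =
  translate_mean B psi (translate_mean A phi f).
Proof.
apply/funext => x; rewrite /translate_mean mean_exchange.
by apply: eq_mean => j _; apply: eq_mean => i _; rewrite addrAC.
Qed.

Lemma translate_meanB (I : finType) (A : {set I}) (phi : I -> G) (f g : G -> R) :
  translate_mean A phi (fun x => f x - g x) =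
  fun x => translate_mean A phi f x - translate_mean A phi g x.
Proof. by apply/funext => x; rewrite /translate_mean meanB. Qed.

End TranslateMean.

Section AlmostPeriods.
Variables (R : realType) (G : finZmodType) (B : {set G}) (f : G -> R).
Variables (l : nat) (delta eta : R).
Hypotheses (B_gt0 : (0 < #|B|)%N) (f01 : forall x, 0 <= f x <= 1).
Hypotheses (l_gt0 : (0 < l)%N) (delta01 : 0 < delta <= 1).
Hypothesis eta_ge : 4 * expR (- (delta ^+ 2 * l%:R / 8)) <= eta.

Let smooth : G -> R := translate_mean B -%R f.
Let empirical (u : {ffun 'I_l -> G}) : G -> R := translate_mean [set: 'I_l] (fun i => - u i) f.
Let good_samples : {set {ffun 'I_l -> G}} := [set u in samples B l |
  mean [set: G] (fun y => (delta < `|smooth y - empirical u y|)%R%:R) <= eta].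

Lemma good_samples_half : #|B|%:R ^+ l <= 2 * #|good_samples|%:R :> R.
Proof.
pose bad u := mean [set: G] (fun y => (delta < `|smooth y - empirical u y|)%R%:R : R).
have eta0 : 0 < eta by apply: lt_le_trans eta_ge; rewrite mulr_gt0 ?expR_gt0.
have bad_mean : mean (samples B l) bad <= eta / 2.
  rewrite mean_exchange; apply: mean_le => [|y _]; first exact: card_setT_finZmod_gt0.
  apply: le_trans (sampling_deviation B_gt0 l_gt0 delta01 (fun b _ => f01 (y - b))) _.
  by move: eta_ge; lra.
have few_bad : mean (samples B l) (fun u => (eta < bad u)%R%:R) <= 1 / 2 :> R.
  rewrite -(ler_pM2r eta0); apply: le_trans (mean_markov eta _) _.
    by move=> u _; apply: mean_ge0 => y _.
  by apply: le_trans bad_mean _; lra.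
have many_good : 1 / 2 <= mean (samples B l) (fun u => (u \in good_samples)%:R) :> R.
  have -> : mean (samples B l) (fun u => (u \in good_samples)%:R) =
      1 - mean (samples B l) (fun u => (eta < bad u)%R%:R) :> R.
    rewrite -[X in _ = X - _](mean_cst (card_samples_gt0 l B_gt0)) -meanB.
    apply: eq_mean => u uB; rewrite [u \in _]inE uB /= -/(bad u) leNgt.
    by case: (_ < _); rewrite ?subr0 ?subrr.
  by lra.
have good_sub : samples B l :&: good_samples = good_samples.
  by apply/finset.setIidPr/fintype.subsetP => u; rewrite inE => /andP[].
rewrite mean_mem good_sub ler_pdivlMr ?ltr0n ?card_samples_gt0 // in many_good.
by rewrite -natrX -card_samples; lra.
Qed.

(* By pigeonhole some [u] has many diagonal translates among the good samples, and
   all of them approximate [smooth] by translates of the same [empirical u]. *)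
Lemma exists_almost_periods :
  exists (S : {set G}) (phi : G -> R),
  [/\ forall y, 0 <= phi y <= 1,
      (#|B|%:R / #|G|%:R) ^+ l <= 2 * (#|S|%:R / #|G|%:R) :> R &
      forall t, t \in S ->
        mean [set: G] (fun y => (delta < `|smooth (y - t) - phi y|)%R%:R) <= eta].
Proof.
pose diag (t : G) : {ffun 'I_l -> G} := [ffun=> t].
have [u u_ge] := exists_dense_fiber R diag good_samples.
exists [set t | u - diag t \in good_samples], (empirical u); split.
- by move=> y; apply: mean_itv01 => //; rewrite cardsT card_ord.
- rewrite card_ffun card_ord natrX in u_ge.
  rewrite expr_div_n; apply: le_trans (ler_wpM2l _ u_ge) => //.
  by rewrite mulrA ler_wpM2r ?invr_ge0 ?exprn_ge0 // good_samples_half.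
- move=> t; rewrite !inE => /andP[_]; rewrite -(mean_reindex_inj _ (addIr (- t))).
  congr (_ <= _); apply: eq_mean => y _; congr (_ < `|_ - _|)%R%:R.
  by apply: eq_mean => i _; rewrite !ffunE opprB addrA subrK.
Qed.

End AlmostPeriods.

(** * Fourier analysis on [F_q^n] *)

Section AdditiveCharacters.
Variable C : numClosedFieldType.

Record additive_char (G : zmodType) (chi : G -> C) : Prop := AdditiveChar {
  charD : {morph chi : a b / a + b >-> a * b};
  norm_char : forall a, `|chi a| = 1 }.

Section CharacterTheory.
Variables (G : zmodType) (chi : G -> C).
Hypothesis chi_char : additive_char chi.

Lemma char_neq0 a : chi a != 0.
Proof. by rewrite -normr_eq0 (norm_char chi_char) oner_eq0. Qed.

Lemma char0 : chi 0 = 1.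
Proof. by apply: (mulIf (char_neq0 0)); rewrite -(charD chi_char) addr0 mul1r. Qed.

Lemma charN a : chi (- a) = (chi a)^*.
Proof.
apply: (mulfI (char_neq0 a)).
by rewrite -(charD chi_char) subrr char0 -normCK (norm_char chi_char) expr1n.
Qed.

Lemma charB a b : chi (a - b) = chi a * (chi b)^*.
Proof. by rewrite (charD chi_char) charN. Qed.

Lemma additive_char_comp (G' : zmodType) (f : G' -> G) :
  {morph f : a b / a + b} -> additive_char (chi \o f).
Proof.
move=> fD; split=> [a b | a] /=; last exact: (norm_char chi_char).
by rewrite fD (charD chi_char).
Qed.

End CharacterTheory.

Lemma sum_char_eq0 (G : finZmodType) (chi : G -> C) a :
  additive_char chi -> chi a != 1 -> \sum_x chi x = 0.
Proof.
move=> chi_char chi_a; apply/eqP.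
have : (1 - chi a) * \sum_x chi x == 0.
  rewrite mulrBl mul1r subr_eq0 mulr_sumr (reindex_inj (addrI a)).
  by under eq_bigr => x _ do rewrite (charD chi_char).
by rewrite mulf_eq0 subr_eq0 eq_sym (negbTE chi_a).
Qed.

Lemma exists_nontrivial_unity_root p : (1 < p)%N -> exists2 z : C, z ^+ p = 1 & z != 1.
Proof.
move=> p_gt1; pose P : {poly C} := \poly_(i < p) 1.
have sizeP : size P != 1%N by rewrite size_poly_eq ?oner_eq0 // gtn_eqF.
have [z /rootP] := closed_rootP P sizeP; rewrite horner_poly.
under eq_bigr => i _ do rewrite mul1r.
move=> sum_z; exists z; first by apply/eqP; rewrite -subr_eq0 subrX1 sum_z mulr0.
apply: contra_eq_neq sum_z => ->; under eq_bigr => i _ do rewrite expr1n.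
by rewrite sumr_const card_ord pnatr_eq0 gtn_eqF // ltnW.
Qed.

Lemma exists_nontrivial_char (K : finFieldType) :
  exists2 chi : K -> C, additive_char chi & exists a, chi a != 1.
Proof.
have [p p_prime charK] := finPcharP K.
pose L := pPrimeCharType charK.
have p_gt1 := prime_gt1 p_prime; have [z zp1 z_neq1] := exists_nontrivial_unity_root p_gt1.
have norm_z : `|z| = 1.
  by apply/eqP; rewrite -(pexpr_eq1 (ltnW p_gt1)) // -normrX zp1 normr1.
pose b := vbasis {:L}; pose i0 := Ordinal (adim_gt0 {:L}).
pose e (x : K) : nat := coord b i0 (x : L).
have eD x y : e (x + y) = ((e x + e y) %% p)%N.
  by rewrite /e linearD /= [X in (_ %% X)%N]Fp_cast.
exists (fun x => z ^+ e x).
  split=> [x y|x]; last by rewrite normrX norm_z expr1n.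
  by rewrite eD expr_mod // exprD.
by exists (b`_0 : L); rewrite /e (coord_free i0 i0) ?(basis_free (vbasisP _)) // eqxx expr1.
Qed.

End AdditiveCharacters.

Section DotProduct.
Variables (K : finFieldType) (n : nat).
Local Notation V := 'rV[K]_n.
Implicit Types (v w x y : V) (L : seq V).

Definition dot v x : K := (v *m x^T) 0 0.

Lemma dotC v x : dot v x = dot x v.
Proof. by rewrite /dot -[in LHS](trmxK (v *m x^T)) trmx_mul trmxK mxE. Qed.

Lemma dotDl v w x : dot (v + w) x = dot v x + dot w x.
Proof. by rewrite /dot mulmxDl mxE. Qed.

Lemma dotDr v x y : dot v (x + y) = dot v x + dot v y.
Proof. by rewrite dotC dotDl !(dotC v). Qed.

Lemma dotZl a v x : dot (a *: v) x = a * dot v x.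
Proof. by rewrite /dot -scalemxAl mxE. Qed.

Lemma dotZr a v x : dot v (a *: x) = a * dot v x.
Proof. by rewrite dotC dotZl dotC. Qed.

Lemma dotBr v x y : dot v (x - y) = dot v x - dot v y.
Proof. by rewrite dotDr -scaleN1r dotZr mulN1r. Qed.

Lemma dot0r v : dot v 0 = 0.
Proof. by rewrite -(scale0r v) dotZr mul0r. Qed.

Lemma exists_dot_representation (phi : {scalar V}) : exists u, phi =1 dot^~ u.
Proof.
exists (\row_i phi (delta_mx 0 i)) => w; rewrite {1}(row_sum_delta w) linear_sum /dot mxE.
by apply: eq_bigr => i _; rewrite linearZ !mxE.
Qed.

Lemma free_cons_exists_dot v L : free (v :: L) ->
  exists2 u, dot v u = 1 & forall w, w \in L -> dot w u = 0.
Proof.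
move=> vL_free; pose X := in_tuple (v :: L).
have [u uE] := exists_dot_representation (coord X ord0).
have dot_u (j : 'I_(size (v :: L))) : dot (v :: L)`_j u = (j == ord0)%:R.
  by rewrite -uE; exact: (coord_free (X := X)).
exists u => [|w /(nthP 0)[i i_lt <-]]; first exact: (dot_u ord0).
exact: (dot_u (@Ordinal (size (v :: L)) i.+1 i_lt)).
Qed.

Lemma dot_nondegenerate x : x != 0 -> exists v, dot v x != 0.
Proof.
move=> x_neq0; have [|u xu1 _] := @free_cons_exists_dot x [::].
  by rewrite free_cons span_nil memv0 x_neq0 nil_free.
by exists u; rewrite dotC xu1 oner_eq0.
Qed.

Lemma dot_span_eq0 L v x : v \in <<L>>%VS -> (forall w, w \in L -> dot w x = 0) -> dot v x = 0.
Proof.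
move=> /(@coord_span _ _ _ (in_tuple L)) -> dot_L.
elim/big_ind: _ => [|v1 v2 e1 e2|i _]; rewrite ?dotDl ?e1 ?e2 ?addr0 //.
  by rewrite dotC dot0r.
by rewrite dotZl dot_L ?mulr0 // mem_nth.
Qed.

Definition annihilator L : {vspace V} :=
  lker (linfun (@mulmxr K 1 _ _ (\matrix_(j < size L) L`_j)^T)).

Lemma mem_annihilator L x :
  reflect (forall v, v \in L -> dot v x = 0) (x \in annihilator L).
Proof.
have entryE (j : 'I_(size L)) : (x *m (\matrix_(j < size L) L`_j)^T) 0 j = dot L`_j x.
  by rewrite dotC /dot !mxE; apply: eq_bigr => i _; rewrite !mxE.
rewrite memv_ker lfunE /=; apply: (iffP eqP) => [prod0 v /(nthP 0)[j j_lt <-] | dot0].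
  by have := entryE (Ordinal j_lt); rewrite prod0 mxE.
by apply/rowP => j; rewrite entryE mxE dot0 // mem_nth.
Qed.

Lemma codim_annihilator_le L : (n - \dim (annihilator L) <= size L)%N.
Proof.
have := limg_ker_dim (linfun (@mulmxr K 1 _ _ (\matrix_(j < size L) L`_j)^T)) fullv.
rewrite capfv -/(annihilator L) dimvf /dim /= mul1n => dimE.
rewrite leq_subLR -{1}dimE leq_add2l.
by apply: leq_trans (dimvS (subvf _)) _; rewrite dimvf /dim /= mul1n.
Qed.

Lemma mean_prod_dot_free (R : numFieldType) L (F : V -> K -> R) : free L ->
  mean [set: V] (fun x => \prod_(v <- L) F v (dot v x)) = \prod_(v <- L) mean [set: K] (F v).
Proof.
have V_gt0 := card_setT_finZmod_gt0 V; have K_gt0 := card_setT_finZmod_gt0 K.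
elim: L => [|v L IHL] vL_free.
  by under eq_mean => x _ do rewrite big_nil; rewrite mean_cst // big_nil.
have [u vu1 Lu0] := free_cons_exists_dot vL_free.
move: (vL_free); rewrite free_cons => /andP[_ /IHL {}IHL]; rewrite big_cons -IHL -meanZl.
pose G x := \prod_(w <- L) F w (dot w x).
(* Translating along [u] changes the value of [v] and of no form in [L]. *)
have shift t : mean [set: V] (fun x => F v (dot v x) * G x) =
    mean [set: V] (fun x => F v (dot v x + t) * G x).
  rewrite -(mean_reindex_inj _ (addIr (t *: u))); apply: eq_mean => x _.
  rewrite dotDr dotZr vu1 mulr1; congr (_ * _).
  by apply: eq_big_seq => w wL; rewrite dotDr dotZr Lu0 // mulr0 addr0.
under eq_mean => x _ do rewrite big_cons -/(G x).
rewrite -[LHS](mean_cst K_gt0); under eq_mean => t _ do rewrite (shift t).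
rewrite mean_exchange; apply: eq_mean => x _.
by rewrite meanZr (mean_reindex_inj (F v) (addrI _)).
Qed.

End DotProduct.

Lemma exists_free_subset_span (K : fieldType) (vT : vectType K) (X : seq vT) :
  exists L, [/\ free L, {subset L <= X} & <<L>>%VS = <<X>>%VS].
Proof.
elim: X => [|v X [L [L_free LX spanL]]]; first by exists [::]; rewrite nil_free.
have subX w : w \in L -> w \in v :: X by move=> /LX; rewrite inE => ->; rewrite orbT.
have [vX | vX] := boolP (v \in <<X>>%VS).
  by exists L; split=> //; rewrite span_cons spanL; apply/esym/addv_idPr; rewrite -memvE.
exists (v :: L); split; rewrite ?free_cons ?spanL ?vX // ?span_cons ?spanL //.
by move=> w; rewrite inE => /predU1P[-> | /subX //]; exact: mem_head.
Qed.

Section FourierTransform.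
Variables (C : numClosedFieldType) (K : finFieldType) (n : nat) (chi : K -> C).
Hypothesis chi_char : additive_char chi.
Local Notation V := 'rV[K]_n.
Implicit Types (f g : V -> C) (v x : V).

Definition fourier f v : C := \sum_x f x * chi (dot v x).

Lemma fourierB f g v : fourier (fun x => f x - g x) v = fourier f v - fourier g v.
Proof. by rewrite -sumrB; apply: eq_bigr => x _; rewrite mulrBl. Qed.

Lemma fourier_translate f a v :
  fourier (fun x => f (x + a)) v = fourier f v * (chi (dot v a))^*.
Proof.
rewrite /fourier (reindex_inj (addIr (- a))) mulr_suml; apply: eq_bigr => x _ /=.
by rewrite subrK dotBr (charB chi_char) mulrA.
Qed.

Lemma fourier_translate_mean (I : finType) (A : {set I}) (phi : I -> V) f v :
  fourier (translate_mean A phi f) v =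
  fourier f v * (mean A (fun i => chi (dot v (phi i))))^*.
Proof.
transitivity (mean A (fun i => fourier (fun x => f (x + phi i)) v)).
  rewrite /fourier /mean exchange_big mulr_suml; apply: eq_bigr => x _.
  by rewrite mulrAC mulr_suml.
under eq_mean => i _ do rewrite fourier_translate.
by rewrite meanZl rmorph_mean.
Qed.

Section Parseval.
Hypothesis chi_nontrivial : exists a, chi a != 1.

Lemma sum_char_dot x : \sum_v chi (dot v x) = #|{: V}|%:R * (x == 0)%:R.
Proof.
have [-> | x_neq0] := eqVneq x 0.
  under eq_bigr => v _ do rewrite dot0r (char0 chi_char).
  by rewrite sumr_const mulr1.
have [v vx] := dot_nondegenerate x_neq0; have [a chi_a] := chi_nontrivial.
have chi_dot_char : additive_char (chi \o @dot K n ^~ x).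
  by apply: additive_char_comp => // v1 v2; exact: dotDl.
rewrite mulr0; apply: (sum_char_eq0 (a := (a / dot v x) *: v) chi_dot_char).
by rewrite /= dotZl mulfVK.
Qed.

Lemma parseval f : \sum_v `|fourier f v| ^+ 2 = #|{: V}|%:R * \sum_x `|f x| ^+ 2.
Proof.
transitivity (\sum_v \sum_x \sum_y f x * (f y)^* * chi (dot v (x - y))).
  apply: eq_bigr => v _; rewrite normCK rmorph_sum mulr_suml; apply: eq_bigr => x _.
  rewrite mulr_sumr; apply: eq_bigr => y _ /=.
  by rewrite rmorphM dotBr (charB chi_char) mulrACA.
rewrite exchange_big mulr_sumr; apply: eq_bigr => x _.
rewrite exchange_big (bigD1 x) //= -mulr_sumr sum_char_dot subrr eqxx mulr1 big1 ?addr0.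
  by rewrite mulrC normCK.
by move=> y yx; rewrite -mulr_sumr sum_char_dot subr_eq0 eq_sym (negbTE yx) !mulr0.
Qed.

End Parseval.
End FourierTransform.

Definition diff_mean (R : numFieldType) (G : finZmodType) (T : {set G}) : (G -> R) -> G -> R :=
  translate_mean (finset.setX T T) (fun q => q.1 - q.2).

Section LargeSpectrum.
Variables (C : numClosedFieldType) (K : finFieldType) (n : nat) (chi : K -> C).
Local Notation V := 'rV[K]_n.
Variable T : {set V}.

Definition char_mean (v : V) : C := mean T (fun t => chi (dot v t)).

Definition large_spectrum : {set V} := [set v | 1 / 2 < `|char_mean v|].

Hypotheses (chi_char : additive_char chi) (chi_nontrivial : exists a, chi a != 1).

Lemma fourier_diff_mean (f : V -> C) v :
  fourier chi (diff_mean T f) v = `|char_mean v| ^+ 2 * fourier chi f v.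
Proof.
have pairs_mean : mean (finset.setX T T) (fun q => chi (dot v (q.1 - q.2))) =
    `|char_mean v| ^+ 2.
  rewrite (mean_setX T T (fun t u => chi (dot v (t - u)))) normCK /char_mean -meanZr.
  apply: eq_mean => t _; rewrite rmorph_mean -meanZl; apply: eq_mean => u _.
  by rewrite dotBr (charB chi_char).
by rewrite (fourier_translate_mean chi_char) pairs_mean mulrC rmorphXn /= conj_normC.
Qed.

Lemma iter_diff_mean_l2 k (f : V -> C) :
  (forall v, v \in large_spectrum -> fourier chi f v = 0) ->
  \sum_x `|iter k (diff_mean T) f x| ^+ 2 <= (1 / 16) ^+ k * \sum_x `|f x| ^+ 2.
Proof.
move=> f_spec; have V_gt0 := natr_card_finZmod_gt0 C V.
have iterE v : fourier chi (iter k (diff_mean T) f) v =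
    (`|char_mean v| ^+ 2) ^+ k * fourier chi f v.
  elim: k => [|k IHk] /=; first by rewrite mul1r.
  by rewrite fourier_diff_mean IHk mulrA -exprS.
rewrite -(ler_pM2l V_gt0) mulrCA -!(parseval chi_char chi_nontrivial) mulr_sumr.
apply: ler_sum => v _; rewrite iterE.
have [/f_spec -> | ] := boolP (v \in large_spectrum).
  by rewrite mulr0 normr0 expr0n /= mulr0.
rewrite inE -real_leNgt ?ger0_real ?divr_ge0 // => small.
rewrite normrM exprMn ler_wpM2r ?exprn_ge0 // ger0_norm ?exprn_ge0 // [_ ^+ k ^+ 2]exprAC.
have -> : 1 / 16 = (1 / 2) ^+ 2 ^+ 2 :> C by field.
by do 3![apply: lerXn2r; rewrite ?nnegrE ?exprn_ge0 ?divr_ge0 //].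
Qed.

End LargeSpectrum.

(** * Chang's theorem *)

Lemma exists_phase (C : numClosedFieldType) (z : C) : exists2 c, `|c| = 1 & c * z = `|z|.
Proof.
have [-> | z_neq0] := eqVneq z 0; first by exists 1; rewrite ?normr1 // mulr0 normr0.
have norm_z_neq0 : `|z| != 0 by rewrite normr_eq0.
exists (z^* / `|z|); first by rewrite normrM norm_conjC normfV normr_id divff.
by rewrite mulrAC -normCKC expr2 mulfK.
Qed.

Section RealPart.
Variable R : realType.

Lemma Re_sum (I : Type) (r : seq I) (P : pred I) (f : I -> R[i]) :
  complex.Re (\sum_(i <- r | P i) f i) = \sum_(i <- r | P i) complex.Re (f i).
Proof. by apply: (big_morph (@complex.Re R)) => // -[? ?] [? ?]. Qed.

Lemma Re_mean (T : finType) (A : {set T}) (f : T -> R[i]) :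
  complex.Re (mean A f) = mean A (fun x => complex.Re (f x)).
Proof.
rewrite /mean -Re_sum -(rmorph_nat (real_complex R)) -fmorphV.
by case: (\sum_(a in A) f a) => x y /=; rewrite mulr0 subr0.
Qed.

Lemma norm_Re_le1 (z : R[i]) : `|z| = 1 -> `|complex.Re z| <= 1.
Proof. by move=> z1; rewrite -lecR -[leRHS]z1; exact: normc_ge_Re. Qed.

Lemma lt_Re_norm (z : R[i]) : (1 / 2 < `|z|) = (1 / 2 < complex.Re `|z|).
Proof.
rewrite -ltcR RRe_real ?normr_real //; congr (_ < _).
by rewrite rmorphM fmorphV rmorph1 rmorph_nat.
Qed.

End RealPart.

Section Chang.
Variables (R : realType) (K : finFieldType) (n : nat) (chi : K -> R[i]).
Hypotheses (chi_char : additive_char chi) (chi_nontrivial : exists a, chi a != 1).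
Local Notation V := 'rV[K]_n.

Lemma mean_expR_sum_char_free (c : V -> R[i]) (lam : R) (L : seq V) :
  `|lam| <= 1 / 2 -> (forall v, `|c v| = 1) -> free L ->
  mean [set: V] (fun x => expR (lam * \sum_(v <- L) complex.Re (c v * chi (dot v x)))) <=
  expR (2 * lam ^+ 2) ^+ size L.
Proof.
move=> lam_le c1 L_free; pose F v a := expR (lam * complex.Re (c v * chi a)).
rewrite (eq_mean (g := fun x => \prod_(v <- L) F v (dot v x))) => [|x _]; last first.
  by rewrite mulr_sumr expR_sum.
rewrite (mean_prod_dot_free F L_free).
have -> : expR (2 * lam ^+ 2) ^+ size L = \prod_(v <- L) expR (2 * lam ^+ 2).
  by rewrite big_const_seq count_predT -Monoid.iteropE.
apply: ler_prod => v _; rewrite mean_ge0 => [/=|a _]; last exact: expR_ge0.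
apply: mean_expR_centered_le => //.
- exact: card_setT_finZmod_gt0.
- by move=> a _; rewrite norm_Re_le1 // normrM c1 (norm_char chi_char) mulr1.
- have [a chi_a] := chi_nontrivial.
  by rewrite -Re_mean meanZl mean_setT (sum_char_eq0 chi_char chi_a) mul0r mulr0.
Qed.

Variable T : {set V}.
Hypothesis T_gt0 : (0 < #|T|)%N.

Lemma free_large_spectrum_size_le (L : seq V) : free L -> {subset L <= large_spectrum chi T} ->
  expR ((size L)%:R / 32) <= #|{: V}|%:R / #|T|%:R :> R.
Proof.
move=> L_free L_spec.
have /choice[c cP] v : exists c, `|c| = 1 /\ c * char_mean chi T v = `|char_mean chi T v|.
  by have [c] := exists_phase (char_mean chi T v); exists c.
pose X x := \sum_(v <- L) complex.Re (c v * chi (dot v x)).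
have X_mean : (size L)%:R / 2 <= mean T X.
  have -> : mean T X = \sum_(v <- L) complex.Re `|char_mean chi T v|.
    rewrite /mean exchange_big mulr_suml; apply: eq_bigr => v _.
    by rewrite -(cP v).2 -meanZl Re_mean.
  have -> : (size L)%:R / 2 = \sum_(v <- L) (1 / 2) :> R.
    by rewrite big_const_seq count_predT iter_addr_0 div1r mulr_natl.
  rewrite big_seq [leRHS]big_seq; apply: ler_sum => v /L_spec.
  by rewrite inE lt_Re_norm => /ltW.
have lower : expR ((size L)%:R / 16) <= mean T (fun x => expR (1 / 8 * X x)).
  apply: le_trans (expR_mean_le T_gt0 _); rewrite ler_expR meanZl; lra.
have upper : mean T (fun x => expR (1 / 8 * X x)) <=
    expR ((size L)%:R / 32) * (#|{: V}|%:R / #|T|%:R).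
  apply: le_trans (mean_le_sum _ (fun x => expR_ge0 _)) _.
  rewrite mulrA ler_wpM2r ?invr_ge0 // -ler_pdivrMr ?natr_card_finZmod_gt0 // -mean_setT.
  apply: le_trans (mean_expR_sum_char_free _ (fun v => (cP v).1) L_free) _.
    by rewrite ger0_norm; lra.
  by rewrite -expRM_natl ler_expR; lra.
have := le_trans lower upper.
have -> : (size L)%:R / 16 = (size L)%:R / 32 + (size L)%:R / 32 :> R by lra.
by rewrite expRD ler_pM2l ?expR_gt0.
Qed.

Lemma exists_large_spectrum_annihilator :
  exists2 W : {vspace V}, expR ((n - \dim W)%:R / 32) <= #|{: V}|%:R / #|T|%:R :> R &
    forall v x, v \in large_spectrum chi T -> x \in W -> dot v x = 0.
Proof.
have [L [L_free L_sub L_span]] := exists_free_subset_span (enum (large_spectrum chi T)).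
exists (annihilator L) => [|v x v_spec /mem_annihilator x_perp].
  apply: le_trans (free_large_spectrum_size_le L_free _) => [|v /L_sub]; last first.
    by rewrite mem_enum.
  by rewrite ler_expR ler_wpM2r ?invr_ge0 // ler_nat codim_annihilator_le.
by apply: dot_span_eq0 x_perp; rewrite L_span memv_span // mem_enum.
Qed.

End Chang.

(** * Almost periodicity along a subspace *)

Section DifferenceMeans.
Variables (R : realFieldType) (G : finZmodType).
Implicit Types (f g F : G -> R) (B T W : {set G}).

Lemma diff_meanE B f : diff_mean B f = translate_mean B id (translate_mean B -%R f).
Proof.
apply/funext => x; rewrite /diff_mean /translate_mean.
rewrite (mean_setX B B (fun b b' => f (x + (b - b')))).
by do 2![apply: eq_mean => ? _]; rewrite addrA.
Qed.

Lemma iter_diff_mean_translate_mean T B k f :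
  iter k (diff_mean T) (translate_mean B id f) = translate_mean B id (iter k (diff_mean T) f).
Proof. by elim: k => [//|k IHk]; rewrite iterS IHk /diff_mean translate_mean_comm. Qed.

Lemma norm_translate_meanB_le B f g (delta : R) x : (0 < #|B|)%N ->
  (forall y, `|f y - g y| <= 1) ->
  mean [set: G] (fun y => (delta < `|f y - g y|)%R%:R) <= delta * (#|B|%:R / #|G|%:R) ->
  `|translate_mean B id f x - translate_mean B id g x| <= 2 * delta.
Proof.
move=> B_gt0 fg_le1 rarely_far; pose far y : R := (delta < `|f y - g y|)%R%:R.
have b_gt0 : 0 < #|B|%:R :> R by rewrite ltr0n.
have delta_ge0 : 0 <= delta.
  rewrite -(pmulr_lge0 delta (divr_gt0 b_gt0 (natr_card_finZmod_gt0 R G))).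
  by apply: le_trans rarely_far; apply: mean_ge0 => y _.
rewrite -meanB; apply: le_trans (ler_norm_mean _ _) _.
apply: (@le_trans _ _ (mean B (fun b => delta + far (x + b)))).
  apply: ler_mean => b _; rewrite /far.
  case: ltP => [_ | //]; last by rewrite addr0.
  by apply: le_trans (fg_le1 _) _; rewrite lerDr.
rewrite meanD mean_cst // mulr_natl mulr2n lerD2l.
apply: le_trans (mean_le_sum _ _) _ => //.
have -> : \sum_b far (x + b) = \sum_y far y by rewrite [RHS](reindex_inj (addrI x)).
move: rarely_far; rewrite mean_setT ler_pdivrMr ?natr_card_finZmod_gt0 // ler_pdivrMr //.
by rewrite -mulrA mulfVK // gt_eqF ?natr_card_finZmod_gt0.
Qed.

Lemma iter_diff_mean_close T F k (e : R) x : (0 < #|T|)%N ->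
  (forall y t u, t \in T -> u \in T -> `|F (y + (t - u)) - F y| <= e) ->
  `|iter k (diff_mean T) F x - F x| <= k%:R * e.
Proof.
move=> T_gt0 F_per; have TT_gt0 : (0 < #|finset.setX T T|)%N by rewrite cardsX muln_gt0 T_gt0.
elim: k x => [|k IHk] x; first by rewrite subrr normr0 mul0r.
rewrite iterS -[X in _ - X](mean_cst TT_gt0) -meanB.
apply: norm_mean_le => // -[t u]; rewrite finset.in_setX /= => /andP[tT uT].
apply: le_trans (ler_distD (F (x + (t - u))) _ _) _.
by rewrite -natr1 mulrDl mul1r lerD ?IHk ?F_per.
Qed.

Definition sub_mean W F : G -> R := fun x => F x - translate_mean W id F x.

Lemma sub_mean_translate_mean W B F :
  sub_mean W (translate_mean B id F) = translate_mean B id (sub_mean W F).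
Proof. by rewrite /sub_mean translate_meanB translate_mean_comm. Qed.

Lemma norm_sub_mean_shift_le W F (s : G) (e : R) y : (0 < #|W|)%N ->
  (forall x, `|F (x + s) - F x| <= e) -> `|sub_mean W F (y + s) - sub_mean W F y| <= 2 * e.
Proof.
move=> W_gt0 F_per.
have mean_per : `|translate_mean W id F (y + s) - translate_mean W id F y| <= e.
  by rewrite -meanB; apply: norm_mean_le => // w _; rewrite addrAC F_per.
have -> : sub_mean W F (y + s) - sub_mean W F y =
    F (y + s) - F y - (translate_mean W id F (y + s) - translate_mean W id F y).
  by rewrite /sub_mean; ring.
by rewrite mulr_natl mulr2n; apply: le_trans (ler_normB _ _) _; exact: lerD.
Qed.

End DifferenceMeans.

Lemma exists_diff_mean_periods (R : realType) (G : finZmodType) (B : {set G}) (f : G -> R)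
    (l : nat) (delta : R) :
  (0 < #|B|)%N -> (forall x, 0 <= f x <= 1) -> (0 < l)%N -> 0 < delta <= 1 ->
  4 * expR (- (delta ^+ 2 * l%:R / 8)) <= delta * (#|B|%:R / #|G|%:R) ->
  exists T : {set G}, [/\ (0 < #|T|)%N,
    (#|B|%:R / #|G|%:R) ^+ l <= 2 * (#|T|%:R / #|G|%:R) :> R &
    forall x t u, t \in T -> u \in T ->
      `|diff_mean B f (x + (t - u)) - diff_mean B f x| <= 4 * delta].
Proof.
move=> B_gt0 f01 l_gt0 delta01 l_large.
have [T [phi [phi01 T_dense T_per]]] := exists_almost_periods B_gt0 f01 l_gt0 delta01 l_large.
have near_phi t x : t \in T ->
    `|diff_mean B f (x - t) - translate_mean B id phi x| <= 2 * delta.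
  move=> tT; rewrite diff_meanE; pose smooth := translate_mean B -%R f.
  have -> : translate_mean B id smooth (x - t) =
      translate_mean B id (fun y => smooth (y - t)) x.
    by apply: eq_mean => b _; rewrite addrAC.
  apply: norm_translate_meanB_le (T_per t tT) => // y.
  by apply: norm_sub_itv01_le1 => //; apply: mean_itv01.
have T_gt0 : (0 < #|T|)%N.
  rewrite -(ltr0n R) -(pmulr_lgt0 _ (_ : 0 < #|G|%:R^-1)) ?invr_gt0 ?natr_card_finZmod_gt0 //.
  rewrite -(pmulr_rgt0 _ (ltr0n R 2)); apply: lt_le_trans T_dense.
  by rewrite exprn_gt0 // divr_gt0 ?natr_card_finZmod_gt0 ?ltr0n.
exists T; split=> // x t u tT uT.
have := near_phi t (x + t) tT; have := near_phi u (x + t) uT.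
rewrite addrK -[x + t - u]addrA => close_u close_t.
rewrite distrC in close_t; apply: le_trans (ler_distD (translate_mean B id phi (x + t)) _ _) _.
by lra.
Qed.

Section RealDamping.
Variables (R : realType) (K : finFieldType) (n : nat) (chi : K -> R[i]).
Hypotheses (chi_char : additive_char chi) (chi_nontrivial : exists a, chi a != 1).
Local Notation V := 'rV[K]_n.
Implicit Types (f : V -> R) (B T W : {set V}).

Definition complexify f : V -> R[i] := fun x => real_complex R (f x).

Lemma complexify_translate_mean (I : finType) (A : {set I}) (phi : I -> V) f :
  complexify (translate_mean A phi f) = translate_mean A phi (complexify f).
Proof. by apply/funext => x; rewrite /complexify /translate_mean rmorph_mean. Qed.

Lemma iter_diff_mean_l2_real T k f :
  (forall v, v \in large_spectrum chi T -> fourier chi (complexify f) v = 0) ->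
  \sum_x iter k (diff_mean T) f x ^+ 2 <= (1 / 16) ^+ k * \sum_x f x ^+ 2.
Proof.
have iterE : complexify (iter k (diff_mean T) f) = iter k (diff_mean T) (complexify f).
  by elim: k => [//|k IHk]; rewrite !iterS -IHk /diff_mean complexify_translate_mean.
have sqE g : \sum_x `|complexify g x| ^+ 2 = real_complex R (\sum_x g x ^+ 2).
  rewrite rmorph_sum; apply: eq_bigr => x _.
  by rewrite real_normK ?rmorphXn //; apply/complex_realP; exists (g x).
move=> /(iter_diff_mean_l2 chi_char chi_nontrivial k); rewrite -iterE !sqE -lecR.
by rewrite rmorphM rmorphXn rmorphM fmorphV rmorph1 rmorph_nat.
Qed.

Lemma fourier_sub_mean_eq0 f W v : (0 < #|W|)%N -> (forall w, w \in W -> dot v w = 0) ->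
  fourier chi (complexify (sub_mean W f)) v = 0.
Proof.
move=> W_gt0 vW.
have -> : complexify (sub_mean W f) =
    fun x => complexify f x - translate_mean W id (complexify f) x.
  by apply/funext => x; rewrite -complexify_translate_mean /complexify rmorphB.
rewrite fourierB (fourier_translate_mean chi_char).
rewrite (eq_mean (g := fun=> 1)) => [|w wW]; last by rewrite vW // (char0 chi_char).
by rewrite mean_cst // conjC1 mulr1 subrr.
Qed.

Lemma sqr_mean_iter_diff_mean_le B T k f x : (0 < #|B|)%N -> (forall y, `|f y| <= 1) ->
  (forall v, v \in large_spectrum chi T -> fourier chi (complexify f) v = 0) ->
  translate_mean B id (iter k (diff_mean T) f) x ^+ 2 * (#|B|%:R / #|{: V}|%:R) <=
  (1 / 16) ^+ k.
Proof.
move=> B_gt0 f_le1 f_spec; have b_gt0 : 0 < #|B|%:R :> R by rewrite ltr0n.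
rewrite mulrA ler_pdivrMr ?natr_card_finZmod_gt0 // -ler_pdivlMr //.
rewrite -[X in X ^+ 2]/(mean B _) -real_normK ?num_real //.
apply: le_trans (norm_mean_exprn_le B_gt0 _ _) _.
apply: le_trans (mean_le_sum _ _) _ => [y|]; first exact: exprn_ge0.
rewrite (reindex_inj (addrI (- x))) /= ler_pM2r ?invr_gt0 //.
under eq_bigr => y _ do rewrite addNKr real_normK ?num_real //.
apply: le_trans (iter_diff_mean_l2_real k f_spec) _; rewrite ler_wpM2l ?exprn_ge0 ?divr_ge0 //.
rewrite -sumr_const; apply: ler_sum => y _.
by rewrite -[leLHS]real_normK ?num_real // exprn_ile1.
Qed.

End RealDamping.

Section AlmostPeriodicity.
Variables (R : realType) (K : finFieldType) (n : nat).
Local Notation V := 'rV[K]_n.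

Lemma vspace_set_gt0 (W : {vspace V}) : (0 < #|[set y | y \in W]|)%N.
Proof. by apply/card_gt0P; exists 0; rewrite inE mem0v. Qed.

Variables (B : {set V}) (f : V -> R).
Hypotheses (B_gt0 : (0 < #|B|)%N) (f01 : forall x, 0 <= f x <= 1).
Local Notation density := (#|B|%:R / #|{: V}|%:R : R).

Lemma almost_periodicity (delta kappa : R) (k l : nat) :
  0 < delta <= 1 -> 0 <= kappa -> (0 < l)%N ->
  4 * expR (- (delta ^+ 2 * l%:R / 8)) <= delta * density ->
  (1 / 16) ^+ k <= kappa ^+ 2 * density ->
  exists2 W : {vspace V}, expR ((n - \dim W)%:R / 32) * density ^+ l <= 2 &
    `|diff_mean B f 0 - mean [set y | y \in W] (diff_mean B f)| <= 8 * k%:R * delta + kappa.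
Proof.
move=> delta01 kappa0 l_gt0 l_large k_large.
have V_gt0 := natr_card_finZmod_gt0 R V.
have [T [T_gt0 T_dense T_per]] := exists_diff_mean_periods B_gt0 f01 l_gt0 delta01 l_large.
have [chi chi_char chi_nontrivial] := exists_nontrivial_char R[i] K.
have [W W_codim W_perp] := exists_large_spectrum_annihilator chi_char chi_nontrivial T_gt0.
exists W.
  apply: le_trans (ler_pM _ _ W_codim T_dense) _; rewrite ?expR_ge0 ?exprn_ge0 ?divr_ge0 //.
  by rewrite mulrCA -invf_div mulVf ?mulr1 // gt_eqF // divr_gt0 // ltr0n.
set W0 := [set y | y \in W]; have W0_gt0 : (0 < #|W0|)%N := vspace_set_gt0 W.
pose F := sub_mean W0 (diff_mean B f); pose smooth := translate_mean B -%R f.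
have F_per y t u : t \in T -> u \in T -> `|F (y + (t - u)) - F y| <= 2 * (4 * delta).
  by move=> tT uT; apply: norm_sub_mean_shift_le => // z; exact: T_per.
have smooth01 y : 0 <= smooth y <= 1 by apply: mean_itv01.
(* Iterating [diff_mean T] barely moves [F], which is almost periodic under [T - T], and
   yet nearly annihilates it, since [F] has no frequency in the large spectrum of [T]. *)
have damped : `|iter k (diff_mean T) F 0| <= kappa.
  rewrite /F diff_meanE sub_mean_translate_mean iter_diff_mean_translate_mean.
  rewrite -(@ler_pXn2r _ 2) ?nnegrE // real_normK ?num_real //.
  rewrite -(ler_pM2r (divr_gt0 _ V_gt0 : 0 < density)) ?ltr0n //; apply: le_trans k_large.
  apply: (sqr_mean_iter_diff_mean_le chi_char chi_nontrivial) => // [y | v v_spec].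
    by apply: norm_sub_itv01_le1 => //; apply: mean_itv01.
  by apply: (fourier_sub_mean_eq0 chi_char) => // w; rewrite inE; exact: W_perp.
have undamped := iter_diff_mean_close k 0 T_gt0 F_per; rewrite distrC in undamped.
have -> : diff_mean B f 0 - mean W0 (diff_mean B f) = F 0.
  by congr (_ - _); apply: eq_mean => w _; rewrite add0r.
have := ler_normD (F 0 - iter k (diff_mean T) F 0) (iter k (diff_mean T) F 0).
by rewrite subrK; move: undamped damped; lra.
Qed.

End AlmostPeriodicity.

Section QuantitativeAlmostPeriodicity.
Variable R : realType.
Implicit Types Lambda beta kappa delta theta : R.

Lemma sampling_size_suffices Lambda beta delta l : 0 < delta <= 1 -> expR (- Lambda) <= beta ->
  8 * delta^-1 ^+ 2 * (4 * delta^-1 + Lambda) <= l%:R ->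
  4 * expR (- (delta ^+ 2 * l%:R / 8)) <= delta * beta.
Proof.
move=> /andP[delta0 delta1] beta_ge l_ge.
have exponent_ge : 4 * delta^-1 + Lambda <= delta ^+ 2 * l%:R / 8.
  rewrite ler_pdivlMr // -ler_pdivrMl ?exprn_gt0 // -exprVn.
  by lra.
apply: (@le_trans _ _ (4 * expR (- (4 * delta^-1)) * expR (- Lambda))).
  by rewrite -[leRHS]mulrA -expRD ler_pM2l // ler_expR; lra.
apply: ler_pM; rewrite ?mulr_ge0 ?expR_ge0 // expRN ler_pdivrMr ?expR_gt0 //.
rewrite -ler_pdivrMl //; apply: le_trans (expR_ge1Dx _).
by lra.
Qed.

Lemma expR2_le16 : expR 2 <= 16 :> R.
Proof.
have half_le : expR (1 / 2) <= 2 :> R by have := expR_mul_1B_le1 (1 / 2 : R); lra.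
have -> : 2 = 4%:R * (1 / 2) :> R by lra.
rewrite expRM_natl; have -> : 16 = 2 ^+ 4 :> R by lra.
by apply: lerXn2r; rewrite ?nnegrE ?expR_ge0.
Qed.

Lemma damping_steps_suffice Lambda beta kappa k :
  0 < kappa <= 1 -> 1 <= Lambda -> expR (- Lambda) <= beta -> 2 * (Lambda / kappa) <= k%:R ->
  (1 / 16) ^+ k <= kappa ^+ 2 * beta.
Proof.
move=> /[dup] kappa01 /andP[kappa0 _] Lambda1 beta_ge k_ge.
have Lambda_le : Lambda <= Lambda / kappa by rewrite le_div_le1 //; lra.
have kappa_inv_le : kappa^-1 <= Lambda / kappa by rewrite ler_peMl ?invr_ge0 ?(ltW kappa0).
have kappa_ge : expR (- (k%:R / 2)) <= kappa.
  rewrite expRN -[leRHS]invrK lef_pV2 ?posrE ?expR_gt0 ?invr_gt0 //.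
  by apply: le_trans (expR_ge1Dx _); lra.
apply: (@le_trans _ _ (expR (- (k%:R / 2)) ^+ 2 * expR (- k%:R))).
  rewrite -expRM_natl -expRD [X in expR X](_ : _ = k%:R * (- 2)); last by field.
  rewrite expRM_natl; apply: lerXn2r; rewrite ?nnegrE ?expR_ge0 ?divr_ge0 //.
  by rewrite div1r expRN lef_pV2 ?posrE ?expR_gt0 // expR2_le16.
apply: ler_pM; rewrite ?exprn_ge0 ?expR_ge0 //.
  by apply: lerXn2r; rewrite // nnegrE ?expR_ge0 ?(ltW kappa0).
by apply: le_trans beta_ge; rewrite ler_expR; lra.
Qed.

Lemma codim_le_of_density_bound Lambda beta (c l : nat) :
  1 <= Lambda -> expR (- Lambda) <= beta -> (0 < l)%N ->
  expR (c%:R / 32) * beta ^+ l <= 2 -> c%:R <= 64 * (l%:R * Lambda).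
Proof.
move=> Lambda1 beta_ge l_gt0 codim_bound.
have lLambda_ge1 : 1 <= l%:R * Lambda by rewrite -[leLHS]mulr1 ler_pM // ler1n.
suff : c%:R / 32 <= 1 + l%:R * Lambda by lra.
rewrite -ler_expR expRD -[expR (_ * Lambda)]invrK -expRN ler_pdivlMr ?expR_gt0 //.
apply: (@le_trans _ _ 2); last by have := expR_ge1Dx (1 : R); lra.
apply: le_trans codim_bound; rewrite ler_wpM2l ?expR_ge0 // -mulrN expRM_natl.
by apply: lerXn2r; rewrite // nnegrE ?expR_ge0 //; apply: le_trans beta_ge; exact: expR_ge0.
Qed.

Lemma codim_bound_of_sampling_size Lambda delta theta l :
  0 < theta -> 1 <= Lambda <= delta^-1 -> delta^-1 <= 80 * Lambda / theta ^+ 2 ->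
  l%:R <= 8 * delta^-1 ^+ 2 * (4 * delta^-1 + Lambda) + 1 ->
  64 * (l%:R * Lambda) <= 64 * 41 * 80 ^+ 3 / theta ^+ 6 * Lambda ^+ 4.
Proof.
move=> theta0 /andP[Lambda1 Lambda_le]; move: (delta^-1) Lambda_le => x Lambda_le x_le l_le.
have l_le_cube : l%:R <= 41 * x ^+ 3.
  have : 8 * x ^+ 2 * (4 * x + Lambda) <= 8 * x ^+ 2 * (5 * x).
    by apply: ler_wpM2l; [rewrite mulr_ge0 ?sqr_ge0 | lra].
  by have : 1 <= x ^+ 3 by [apply: exprn_ege1; lra]; lra.
have x_cube_le : x ^+ 3 <= (80 * Lambda / theta ^+ 2) ^+ 3.
  by apply: lerXn2r; rewrite // nnegrE; lra.
have -> : 64 * 41 * 80 ^+ 3 / theta ^+ 6 * Lambda ^+ 4 =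
    64 * (41 * (80 * Lambda / theta ^+ 2) ^+ 3 * Lambda) by field; rewrite gt_eqF.
rewrite ler_pM2l // ler_wpM2r //; first by lra.
by apply: le_trans l_le_cube _; rewrite ler_pM2l.
Qed.

(* With density [exp (- Lambda)], [k ~ Lambda] damping steps are needed, hence precision
   [delta ~ 1 / k] and [l ~ Lambda / delta ^ 2 ~ Lambda ^ 3] samples; the codimension is
   [O(l * Lambda)]. *)
Lemma almost_periodicity_of_density (K : finFieldType) (n : nat) (B : {set 'rV[K]_n})
    (f : 'rV[K]_n -> R) (theta Lambda : R) :
  0 < theta < 1 -> 1 <= Lambda -> (0 < #|B|)%N -> (forall x, 0 <= f x <= 1) ->
  expR (- Lambda) <= #|B|%:R / #|{: 'rV[K]_n}|%:R ->
  exists2 W : {vspace 'rV[K]_n},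
    (n - \dim W)%:R <= 64 * 41 * 80 ^+ 3 / theta ^+ 6 * Lambda ^+ 4 &
    `|diff_mean B f 0 - mean [set y | y \in W] (diff_mean B f)| <= theta.
Proof.
move=> /andP[theta0 theta1] Lambda1 B_gt0 f01 beta_ge.
have Lambda_le : Lambda <= Lambda / theta by rewrite le_div_le1 ?theta0 //; lra.
have [|k k_gt0 /andP[k_ge k_le]] := @exists_natr_between_add1 R (4 * (Lambda / theta)).
  by lra.
have k0 : 0 < k%:R :> R by rewrite ltr0n.
pose delta := theta / (16 * k%:R).
have deltaV : delta^-1 = 16 * k%:R / theta by rewrite invf_div.
have deltaV_ge : 16 * k%:R <= delta^-1 by rewrite deltaV le_div_le1 ?theta0 //; lra.
have delta01 : 0 < delta <= 1 by rewrite -invr_gt0 -invf_ge1 ?divr_gt0 ?mulr_gt0 //; lra.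
have [|l l_gt0 /andP[l_ge l_le]] :=
    @exists_natr_between_add1 R (8 * delta^-1 ^+ 2 * (4 * delta^-1 + Lambda)).
  by apply: mulr_ge0; [rewrite mulr_ge0 ?sqr_ge0 | lra].
have [|||||W W_codim W_close] := @almost_periodicity R K n B f B_gt0 f01 delta (theta / 2) k l.
- by [].
- by lra.
- by [].
- exact: sampling_size_suffices beta_ge l_ge.
- apply: damping_steps_suffice Lambda1 beta_ge _; first by apply/andP; split; lra.
  by rewrite invf_div mulrA; lra.
exists W; last first.
  apply: le_trans W_close _; rewrite [leLHS](_ : _ = theta) // /delta; field.
  by rewrite !gt_eqF.
apply: le_trans (codim_le_of_density_bound Lambda1 beta_ge l_gt0 W_codim) _.
apply: codim_bound_of_sampling_size l_le => //; first by rewrite Lambda1; lra.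
have -> : 80 * Lambda / theta ^+ 2 = 16 * (5 * (Lambda / theta)) / theta.
  by field; rewrite gt_eqF.
by rewrite deltaV ler_pM2r ?invr_gt0 // ler_pM2l //; lra.
Qed.

End QuantitativeAlmostPeriodicity.

(** * The family [A_g] *)

Section FamilyMoments.
Variables (R : realType) (K : finFieldType) (n : nat).
Local Notation V := 'rV[K]_n.
Local Notation N := (#|{: V}|%:R : R).

Let N_gt0 : 0 < N := natr_card_finZmod_gt0 R V.

Lemma sum_ind (B : {set V}) : \sum_x ind R B x = #|B|%:R.
Proof.
rewrite -sum1_card natr_sum [RHS]big_mkcond; apply: eq_bigr => x _.
by rewrite /ind; case: (x \in B).
Qed.

Lemma ind_itv01 (B : {set V}) x : 0 <= ind R B x <= 1.
Proof. by rewrite /ind; case: (x \in B); rewrite /= ?ler01 ?lexx. Qed.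

Lemma inner_mu_sub1_moment_le (f D : V -> R) (t : R) p :
  0 < t -> (forall x, 0 <= D x <= N) -> t * N ^+ 2 <= \sum_x D x ->
  `|inner f (mu_of D) - 1| ^+ p * (t * N) <= \sum_x `|f x - 1| ^+ p.
Proof.
move=> t0 D_bounds D_dense; set s := \sum_x D x in D_dense *.
have tN_gt0 : 0 < t * N by rewrite mulr_gt0.
have s_gt0 : 0 < s by apply: lt_le_trans D_dense; rewrite mulr_gt0 ?exprn_gt0.
pose w x := D x / s.
have w_ge0 x : true -> 0 <= w x by case/andP: (D_bounds x) => ? _; rewrite divr_ge0 // ltW.
have w_sum : \sum_x w x = 1 by rewrite -mulr_suml divff // gt_eqF.
have w_le x : w x * (t * N) <= 1.
  rewrite /w mulrAC ler_pdivrMr // mul1r; apply: le_trans D_dense.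
  by rewrite mulrCA ler_pM2l // expr2 ler_pM2r //; case/andP: (D_bounds x).
have -> : inner f (mu_of D) - 1 = \sum_x w x * (f x - 1).
  rewrite -[X in _ - X]w_sum /inner /avg mulr_suml -sumrB; apply: eq_bigr => x _.
  by rewrite /mu_of /avg -/s /w; field; rewrite !gt_eqF.
apply: le_trans (ler_wpM2r (ltW tN_gt0) (power_mean (fun x => f x - 1) p w_ge0 w_sum)) _.
rewrite mulr_suml; apply: ler_sum => x _.
by rewrite mulrAC ler_piMl ?exprn_ge0.
Qed.

Lemma mu_of_ge0 (f : V -> R) x : (forall y, 0 <= f y) -> 0 <= mu_of f x.
Proof. by move=> f0; rewrite !divr_ge0 // sumr_ge0. Qed.

Variable A : V -> {set V}.

Definition energy : R := (\sum_g #|A g|%:R ^+ 2) / N.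

Definition balanced (g : V) : V -> R := fun y => ind R (A g) y - mean [set: V] (ind R (A g)).

Definition shift_corr (z : V -> V) (x : V) : R :=
  (\sum_g autocorr (ind R (A g)) (x - z g)) / N.

Lemma sum_corr_translateE :
  (fun x => \sum_g corr (ind R (A g)) (ind R (translate (A g) g)) x) = shift_corr id.
Proof.
apply/funext => x; rewrite /shift_corr mulr_suml; apply: eq_bigr => g _.
congr (_ / _); apply: eq_bigr => y _.
by rewrite /ind -(mem_imset (A g) (x - g + y) (addIr g)) addrAC subrK.
Qed.

Lemma sum_corrE :
  (fun x => \sum_g corr (ind R (A g)) (ind R (A g)) x) = shift_corr (fun=> 0).
Proof.
by apply/funext => x; rewrite /shift_corr mulr_suml; apply: eq_bigr => g _; rewrite subr0.
Qed.

Lemma shift_corr_ge0 z x : 0 <= shift_corr z x.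
Proof.
rewrite divr_ge0 // sumr_ge0 // => g _; rewrite sumr_ge0 // => y _.
by rewrite mulr_ge0.
Qed.

Lemma avg_shift_corr z : avg (shift_corr z) = energy / N.
Proof.
rewrite /avg /shift_corr -mulr_suml exchange_big; congr (_ / _ / _).
by apply: eq_bigr => g _; rewrite sum_autocorr sum_ind.
Qed.

Lemma energy_ge (t : R) :
  0 <= t -> t * N ^+ 2 <= \sum_g #|A g|%:R -> t ^+ 2 * N ^+ 2 <= energy.
Proof.
move=> t0 A_dense.
have := norm_mean_exprn_le (card_setT_finZmod_gt0 V) (fun g => #|A g|%:R : R) 2.
rewrite !mean_setT; under [X in _ <= X / _]eq_bigr => g _ do rewrite normr_nat.
apply: le_trans; rewrite -exprMn ger0_norm ?divr_ge0 ?sumr_ge0 //.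
apply: lerXn2r; rewrite ?nnegrE ?mulr_ge0 ?divr_ge0 ?sumr_ge0 //.
by rewrite ler_pdivlMr // -mulrA.
Qed.

Hypothesis energy_gt0 : 0 < energy.

Lemma mu_shift_corrE z x :
  mu_of (shift_corr z) x = (\sum_g autocorr (ind R (A g)) (x - z g)) / energy.
Proof. by rewrite /mu_of avg_shift_corr /shift_corr; field; rewrite !gt_eqF. Qed.

Lemma mu_shift_corr_sub1 z x :
  mu_of (shift_corr z) x - 1 = (\sum_g autocorr (balanced g) (x - z g)) / energy.
Proof.
rewrite /balanced; under eq_bigr => g _ do rewrite autocorr_sub_mean sum_ind.
by rewrite sumrB mulrBl -mulr_suml -/energy divff ?gt_eqF // mu_shift_corrE.
Qed.

Local Notation mu := (mu_of (shift_corr (fun=> 0))).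

Lemma central_moment_shift_le z p :
  \sum_x (mu_of (shift_corr z) x - 1) ^+ p <= \sum_x (mu x - 1) ^+ p.
Proof.
under eq_bigr => x _ do rewrite mu_shift_corr_sub1 expr_div_n.
under [leRHS]eq_bigr => x _ do rewrite mu_shift_corr_sub1 expr_div_n.
rewrite -!mulr_suml ler_pM2r ?invr_gt0 ?exprn_gt0 //.
under [leRHS]eq_bigr => x _ do under eq_bigr => g _ do rewrite subr0.
exact: le_trans (ler_norm _) (norm_moment_shift_le _ _ _).
Qed.

Lemma central_moment_ge0 p : 0 <= \sum_x (mu x - 1) ^+ p.
Proof.
under eq_bigr => x _ do rewrite mu_shift_corr_sub1 expr_div_n.
rewrite -mulr_suml divr_ge0 ?exprn_ge0 ?(ltW energy_gt0) //.
under eq_bigr => x _ do under eq_bigr => g _ do rewrite subr0.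
exact: moment_autocorr_ge0.
Qed.

Definition translated_family (v : V * V) : {set V} := [set u | u - v.2 \in A v.1].

Lemma codegree_translates (x y : V) : codegree R translated_family x y = energy * mu (y - x).
Proof.
rewrite mu_shift_corrE mulrC mulfVK ?gt_eqF // /codegree.
rewrite -(pair_bigA _ (fun g z => (x \in translated_family (g, z))%:R *
  (y \in translated_family (g, z))%:R)) /=; apply: eq_bigr => g _.
rewrite subr0 (reindex_inj (inv_inj (subKr x))); apply: eq_bigr => z _.
by rewrite !inE subKr opprB addrCA addrC.
Qed.

Lemma sum_codegree_translates (P : pred V) p :
  \sum_x \sum_(y | P (y - x)) codegree R translated_family x y ^+ p =
  N * energy ^+ p * \sum_(x | P x) mu x ^+ p.
Proof.
rewrite -mulrA mulr_natl -sumr_const; apply: eq_bigr => x _.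
rewrite mulr_sumr (reindex_inj (addIr x)); apply: eq_big => y; rewrite addrK // => _.
by rewrite codegree_translates addrK exprMn.
Qed.

Lemma exists_set_with_popular_differences (level theta : R) p : 0 < theta ->
  N <= \sum_x mu x ^+ p -> \sum_(x | mu x < level) mu x ^+ p <= theta * \sum_x mu x ^+ p ->
  exists B : {set V}, [/\ (0 < #|B|)%N,
    (energy / N ^+ 2) ^+ p <= 2 * (#|B|%:R / N) ^+ 2 &
    1 - 2 * theta <= diff_mean B (ind R [set x | level <= mu x]) 0].
Proof.
move=> theta0 moment_ge low_negligible.
have Ep_gt0 : 0 < N * energy ^+ p by rewrite mulr_gt0 ?exprn_gt0.
have [||B [B_gt0 B_dense B_popular]] := @dependent_random_choice
    R V (V * V)%type translated_family p (fun x y => level <= mu (y - x)) theta theta0.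
- by rewrite (sum_codegree_translates xpredT) mulr_gt0 //; exact: lt_le_trans moment_ge.
- under eq_bigr => x _ do under eq_bigl => y do rewrite -ltNge.
  rewrite (sum_codegree_translates (fun x => mu x < level)) (sum_codegree_translates xpredT).
  by rewrite mulrCA ler_pM2l.
exists B; split=> //; last first.
  apply: le_trans B_popular _; rewrite mean_exchange /diff_mean /translate_mean.
  rewrite (mean_setX B B (fun b b' => ind R [set x | level <= mu x] (0 + (b - b')))).
  by do 2![apply: ler_mean => ? _]; rewrite add0r /ind inE.
move: B_dense; rewrite (sum_codegree_translates xpredT) card_prod natrM -expr2 => B_dense.
have := le_trans (ler_wpM2l (ltW Ep_gt0) moment_ge) B_dense.
have -> : 2 * (N ^+ 2) ^+ p * #|B|%:R ^+ 2 = N ^+ 2 * (2 * (#|B|%:R / N) ^+ 2 * (N ^+ 2) ^+ p).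
  by field; rewrite gt_eqF.
rewrite mulrAC -expr2 ler_pM2l ?exprn_gt0 // [X in _ -> X <= _]expr_div_n.
by rewrite ler_pdivrMr ?exprn_gt0.
Qed.

End FamilyMoments.

Section StructuredSet.
Variable R : realType.

Lemma expRN_le_powR2 (d : R) : 0 <= d -> expR (- d) <= 2 `^ (- d).
Proof.
move=> d0; rewrite /powR gt_eqF // ler_expR mulNr lerN2 ler_piMr //.
have -> : 2 = 1 + 1 :> R by lra.
by apply: le_ln1Dx; lra.
Qed.

Lemma powR2N_mul_ge1 (d : R) m : d <= m%:R -> 1 <= 2 `^ (- d) * 2 ^+ m.
Proof.
move=> d_le; rewrite -powR_mulrn // -powRD; last by apply/implyP => _; rewrite gt_eqF.
by rewrite -[leLHS](powRr0 2) ler_powR //; lra.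
Qed.

Lemma expR_le_density (d Lambda beta : R) p : 0 <= d -> 0 <= beta -> d * p%:R + 1 <= Lambda ->
  (2 `^ (- d)) ^+ (2 * p) <= 2 * beta ^+ 2 -> expR (- Lambda) <= beta.
Proof.
move=> d0 beta0 Lambda_ge density_ge; rewrite -(@ler_pXn2r _ 2) ?nnegrE ?expR_ge0 //.
have expR1_le : expR (- 1) <= 1 / 2 :> R.
  by rewrite expRN div1r lef_pV2 ?posrE ?expR_gt0 //; have := expR_ge1Dx (1 : R); lra.
have Lambda_le : expR (- Lambda) <= (2 `^ (- d)) ^+ p * (1 / 2).
  apply: (@le_trans _ _ (expR (- d) ^+ p * expR (- 1))).
    by rewrite -expRM_natl -expRD ler_expR; lra.
  rewrite ler_pM ?exprn_ge0 ?expR_ge0 // lerXn2r ?nnegrE ?expR_ge0 ?powR_ge0 //.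
  exact: expRN_le_powR2.
have : expR (- Lambda) ^+ 2 <= ((2 `^ (- d)) ^+ p * (1 / 2)) ^+ 2.
  by rewrite lerXn2r ?nnegrE ?expR_ge0 // mulr_ge0 ?exprn_ge0 ?powR_ge0.
by rewrite exprMn -exprM mulnC; have := sqr_ge0 beta; lra.
Qed.

Lemma invM_sqr_ge1 (a d : R) : 0 < a <= 1 -> 1 <= d -> 1 <= a^-1 * d ^+ 2.
Proof. by move=> /andP[a0 a1] d1; rewrite -[leLHS]mulr1 ler_pM ?exprn_ege1 // invf_ge1. Qed.

Lemma exists_moment_orders (eps theta d : R) : 0 < eps < 1 -> 0 < theta < 1 -> 1 <= d ->
  exists M m, [/\ 4 <= M%:R * eps <= 5, 1 <= 2 `^ (- d) * 2 ^+ m, 1 <= theta * (9 / 8) ^+ m &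
    d * (M * (2 * m))%:R + 1 <= 91 / (eps * theta) * d ^+ 2].
Proof.
move=> /andP[eps0 eps1] /andP[theta0 theta1] d1.
have d_le : d <= d / theta by rewrite le_div_le1 ?theta0 ?(ltW theta1) //; lra.
have theta_le : theta^-1 <= d / theta by rewrite ler_peMl ?invr_ge0 // ltW.
have eps_inv_ge1 : 1 <= eps^-1 by rewrite invf_ge1 // ltW.
have [|m _ /andP[m_ge m_le]] := @exists_natr_between_add1 R (8 * (d / theta)).
  by lra.
have [|M _ /andP[M_ge M_le]] := @exists_natr_between_add1 R (4 / eps); first by lra.
exists M, m; split.
- by rewrite -ler_pdivrMr // M_ge -ler_pdivlMr //; lra.
- by apply: powR2N_mul_ge1; lra.
- have tangent : 1 ^+ m + m%:R * 1 ^+ m.-1 * (9 / 8 - 1) <= (9 / 8 : R) ^+ m.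
    by apply: exprn_ge_tangent; lra.
  rewrite !expr1n in tangent; rewrite mulrC -ler_pdivrMr // div1r.
  by apply: le_trans tangent; lra.
have one_le : 1 <= (eps * theta)^-1 * d ^+ 2.
  by apply: invM_sqr_ge1 => //; rewrite mulr_gt0 // mulr_ile1 // ltW.
have order_le : d * (M * (2 * m))%:R <= 90 * ((eps * theta)^-1 * d ^+ 2).
  have -> : 90 * ((eps * theta)^-1 * d ^+ 2) = d * (5 / eps * (2 * (9 * (d / theta)))).
    by field; rewrite !gt_eqF.
  rewrite ler_pM2l ?natrM; last by lra.
  by rewrite ler_pM ?mulr_ge0 // ?ler_pM2l //; lra.
by lra.
Qed.

Variables (K : finFieldType) (n : nat) (A : 'rV[K]_n -> {set 'rV[K]_n}).
Local Notation V := 'rV[K]_n.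
Local Notation N := (#|{: V}|%:R : R).
Local Notation mu := (mu_of (shift_corr R A (fun=> 0))).

Lemma exists_structured_set (eps theta d : R) :
  0 < eps < 1 -> 0 < theta < 1 -> 1 <= d -> 2 `^ (- d) * N ^+ 2 <= \sum_g #|A g|%:R ->
  eps < `|inner (mu_of (shift_corr R A id)) (mu_of (fun x => #|A x|%:R)) - 1| ->
  exists B : {set V}, [/\ (0 < #|B|)%N,
    expR (- (91 / (eps * theta) * d ^+ 2)) <= #|B|%:R / N &
    1 - 2 * theta <= diff_mean B (ind R [set x | 1 + eps / 8 <= mu x]) 0].
Proof.
move=> eps01 theta01 d1 A_dense far_from_1.
have [/andP[eps0 _] /andP[theta0 _]] := (eps01, theta01).
set t := 2 `^ (- d) in A_dense; have t0 : 0 < t by exact: powR_gt0.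
have N_gt0 := natr_card_finZmod_gt0 R V.
have energy_lower := energy_ge (ltW t0) A_dense.
have energy_gt0 : 0 < energy R A.
  by apply: lt_le_trans energy_lower; rewrite mulr_gt0 ?exprn_gt0.
have mu_ge0 x : 0 <= mu x by apply: mu_of_ge0 => y; exact: shift_corr_ge0.
have [M [m [M_eps t_m theta_m order_le]]] := exists_moment_orders eps01 theta01 d1.
have moment_ge : t * eps ^+ (2 * m) * N <= \sum_x (mu x - 1) ^+ (2 * m).
  apply: le_trans (central_moment_shift_le energy_gt0 id _).
  have D_bounds (x : V) : 0 <= (#|A x|%:R : R) <= N by rewrite ler0n ler_nat max_card.
  have := inner_mu_sub1_moment_le (mu_of (shift_corr R A id)) (2 * m) t0 D_bounds A_dense.
  under eq_bigr => x _ do rewrite exprM real_normK ?num_real // -exprM.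
  apply: le_trans; rewrite -mulrA mulrCA ler_wpM2r ?mulr_ge0 ?(ltW t0) //.
  by rewrite lerXn2r ?nnegrE ?(ltW eps0) ?(ltW far_from_1).
have [||B [B_gt0 B_dense B_popular]] := @exists_set_with_popular_differences
    R K n A energy_gt0 (1 + eps / 8) theta (M * (2 * m)) theta0.
- exact: card_le_moment (central_moment_ge0 energy_gt0) _.
- apply: (lower_level_moment_negligible (f := mu)) moment_ge => //.
  exact: central_moment_ge0.
exists B; split=> //.
apply: expR_le_density order_le _; rewrite ?divr_ge0 //; first by lra.
apply: le_trans B_dense; rewrite exprM.
apply: lerXn2r; rewrite ?nnegrE ?(divr_ge0 (ltW energy_gt0)) ?exprn_ge0 ?(ltW t0) //.
by rewrite ler_pdivlMr ?exprn_gt0.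
Qed.

End StructuredSet.

Section DenseCoset.
Variables (R : realType) (K : finFieldType) (n : nat) (W : {vspace 'rV[K]_n}).
Local Notation V := 'rV[K]_n.
Local Notation W0 := [set y | y \in W].

Lemma convol_mu_subE (f : V -> R) x : convol f (mu_sub R W) x = translate_mean W0 id f x.
Proof.
have V_gt0 := natr_card_finZmod_gt0 R V; have W_gt0 := vspace_set_gt0 W.
rewrite /convol /avg /translate_mean /mean (reindex_inj (addrI x)) [in RHS]big_mkcond.
rewrite !mulr_suml; apply: eq_bigr => w _; rewrite /mu_sub opprD addNKr memvN inE /=.
case: (w \in W); last by rewrite !mulr0 !mul0r.
by rewrite mulr1; field; rewrite !pnatr_eq0 -!lt0n W_gt0 -(ltr0n R) V_gt0.
Qed.

Lemma le_supnorm (f : V -> R) x : `|f x| <= supnorm f.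
Proof. exact: (le_bigmax _ (fun x => `|f x|)). Qed.

Lemma exists_dense_translate (B : {set V}) (f : V -> R) (k : R) : (0 < #|B|)%N ->
  k <= mean W0 (diff_mean B f) -> exists x, k <= translate_mean W0 id f x.
Proof.
move=> B_gt0; rewrite mean_exchange => k_le.
have [|q _ kq] := exists_ge_mean _ k_le; first by rewrite cardsX muln_gt0 B_gt0.
by exists (q.1 - q.2); apply: le_trans kq _; apply: ler_mean => w _; rewrite addrC.
Qed.

Lemma supnorm_convol_mu_sub_ge (B : {set V}) (f : V -> R) (level k : R) :
  (0 < #|B|)%N -> 0 <= level ->
  (forall y, 0 <= f y) -> k <= mean W0 (diff_mean B (ind R [set y | level <= f y])) ->
  level * k <= supnorm (convol f (mu_sub R W)).
Proof.
move=> B_gt0 level0 f0 /(exists_dense_translate B_gt0)[x k_le].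
apply: le_trans (le_supnorm _ x); apply: le_trans (ler_norm _).
rewrite convol_mu_subE; apply: le_trans (ler_wpM2l level0 k_le) _.
rewrite -meanZl; apply: ler_mean => w _; rewrite /ind inE.
by case: (leP level) => [level_le | _]; rewrite ?mulr1 ?mulr0.
Qed.

End DenseCoset.

Theorem theorem3p2 (R : realType) (eps : R) (heps0 : 0 < eps) (heps1 : eps < 1) :
  exists C : R, forall (K : finFieldType) (n : nat) (d : R), 1 <= d ->
  forall A : 'rV[K]_n -> {set 'rV[K]_n},
    2 `^ (- d) * (#|{: 'rV[K]_n}|%:R) ^+ 2 <= (\sum_g #|A g|)%:R ->
    let F := fun x => \sum_g corr (ind R (A g)) (ind R (translate (A g) g)) x in
    let F' := fun x => \sum_g corr (ind R (A g)) (ind R (A g)) x in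
    let D := fun x => (#|A x|)%:R : R in
    `|inner (mu_of F) (mu_of D) - 1| <= eps \/
    exists W : {vspace 'rV[K]_n},
      (n - \dim W)%:R <= C * d ^+ 8 /\
      1 + eps / 32 <= supnorm (convol (mu_of F') (mu_sub R W)).
Proof.
(* Passing to the coset costs [3 * theta], and
   [(1 + eps / 8) * (1 - 3 * theta) >= 1 + eps / 32]. *)
pose theta := eps / 48; pose Lambda_coef := 91 / (eps * theta).
exists (64 * 41 * 80 ^+ 3 / theta ^+ 6 * Lambda_coef ^+ 4) => K n d d1 A A_dense F F' D.
have [|far_from_1] := leP `|inner (mu_of F) (mu_of D) - 1| eps; [by left | right].
rewrite /F sum_corr_translateE in far_from_1; rewrite natr_sum in A_dense.
rewrite /F' sum_corrE.
have eps01 : 0 < eps < 1 by rewrite heps0.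
have theta01 : 0 < theta < 1 by rewrite /theta; apply/andP; split; lra.
have [B [B_gt0 B_dense B_popular]] :=
  exists_structured_set eps01 theta01 d1 A_dense far_from_1.
set S := [set x | _] in B_popular.
have Lambda_ge1 : 1 <= Lambda_coef * d ^+ 2.
  have /invM_sqr_ge1/(_ d1) : 0 < eps * theta <= 1 by rewrite /theta; apply/andP; split; nra.
  by rewrite /Lambda_coef -mulrA; lra.
have [W W_codim W_close] :=
  almost_periodicity_of_density theta01 Lambda_ge1 B_gt0 (ind_itv01 R S) B_dense.
exists W; split.
  by apply: le_trans W_codim _; rewrite (exprM d 2 4) -[leRHS]mulrA -exprMn.
have W_dense : 1 - 3 * theta <= mean [set y | y \in W] (diff_mean B (ind R S)).
  by move: W_close; rewrite ler_norml => /andP[_]; lra.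
have mu_ge0 y : 0 <= mu_of (shift_corr R A (fun=> 0)) y.
  by apply: mu_of_ge0; exact: shift_corr_ge0.
by apply: le_trans (supnorm_convol_mu_sub_ge B_gt0 _ mu_ge0 W_dense); rewrite /theta; nra.
Qed.
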